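(* Let $p\in(0,1)$ be a fixed constant and let $G\sim G(n,p)$. Then $$\lim_{n\to\infty}\frac{1}{\binom{n}{2}}\log_2\mathbb{P}\{G\in\mathcal{C}(n)\}=-r_\ast(p)\,,$$ where $$r_\ast(p)=\begin{cases}-\log_2(1-p)&p\in\big[0,\frac{3-\sqrt{5}}{2}\big)\\[4pt]-\frac{1}{2}\log_2p&p\in\big[\frac{3-\sqrt{5}}{2},1\big]\end{cases}\,.$$
   Context: A graph is claw-free if it has no induced subgraph isomorphic to $K_{1,3}$. $\mathcal{C}(n)$ denotes the set of labeled claw-free graphs on the vertex set $\{1,\dots,n\}$. $G(n,p)$ is the Erdős–Rényi random graph on $\{1,\dots,n\}$ in which each pair is an edge independently with probability $p$. *)

(* Defs.v *)
From HB Require Import structures.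
From mathcomp Require Import all_boot all_order all_algebra.
From mathcomp Require Import all_classical all_reals all_analysis.
Import Order.TTheory GRing.Theory Num.Theory.
Import numFieldNormedType.Exports.

Set Implicit Arguments.
Unset Strict Implicit.
Unset Printing Implicit Defensive.

Local Open Scope ring_scope.

Definition is_sgraph (V : finType) (e : {ffun V * V -> bool}) : bool :=
  [forall x, ~~ e (x, x)] && [forall x, forall y, e (x, y) == e (y, x)].

Record sgraph (V : finType) := SGraph {
  edge_fun : {ffun V * V -> bool};
  edge_funP : is_sgraph edge_fun }.

HB.instance Definition _ (V : finType) := [isSub for @edge_fun V].
HB.instance Definition _ (V : finType) := [Countable of sgraph V by <:].
HB.instance Definition _ (V : finType) := [Finite of sgraph V by <:].

Definition adj (V : finType) (G : sgraph V) : rel V :=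
  fun x y => edge_fun G (x, y).

Lemma is_sgraph_rel (V : finType) (r : rel V) :
  irreflexive r -> symmetric r -> is_sgraph [ffun xy => r xy.1 xy.2].
Proof.
move=> irr_r sym_r; apply/andP; split.
  by apply/forallP => x; rewrite ffunE irr_r.
by apply/forallP => x; apply/forallP => y; rewrite !ffunE sym_r.
Qed.

Definition sgraph_of_rel (V : finType) (r : rel V)
    (irr_r : irreflexive r) (sym_r : symmetric r) : sgraph V :=
  SGraph (is_sgraph_rel irr_r sym_r).

Lemma adj_irr (V : finType) (G : sgraph V) : irreflexive (adj G).
Proof. by move=> x; have /andP[/forallP/(_ x)/negbTE] := edge_funP G. Qed.

Lemma adj_sym (V : finType) (G : sgraph V) : symmetric (adj G).
Proof.
move=> x y; have /andP[_ /forallP/(_ x)/forallP/(_ y)/eqP] := edge_funP G.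
exact.
Qed.

Definition iso (V W : finType) (G : sgraph V) (H : sgraph W) : Prop :=
  exists2 f : V -> W, bijective f & forall x y, adj H (f x) (f y) = adj G x y.

Section Induced.
Variables (V : finType) (G : sgraph V) (S : {set V}).
Let ind_rel : rel {x | x \in S} := fun x y => adj G (val x) (val y).
Lemma ind_rel_irr : irreflexive ind_rel.
Proof. by move=> x; apply: adj_irr. Qed.
Lemma ind_rel_sym : symmetric ind_rel.
Proof. by move=> x y; apply: adj_sym. Qed.
Definition induced : sgraph {x | x \in S} :=
  sgraph_of_rel ind_rel_irr ind_rel_sym.
End Induced.

Section CompleteBipartite.
Variables s t : nat.
Let bip_rel : rel ('I_s + 'I_t)%type := fun x y =>
  match x, y with
  | inl _, inr _ | inr _, inl _ => true
  | _, _ => false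
  end.
Lemma bip_rel_irr : irreflexive bip_rel.
Proof. by case. Qed.
Lemma bip_rel_sym : symmetric bip_rel.
Proof. by case=> [i|i] []. Qed.
Definition complete_bipartite : sgraph ('I_s + 'I_t)%type :=
  sgraph_of_rel bip_rel_irr bip_rel_sym.
End CompleteBipartite.

Definition claw_free (V : finType) (G : sgraph V) : Prop :=
  ~ exists S : {set V}, iso (induced G S) (complete_bipartite 1 3).

Definition claw_free_graphs (n : nat) : {set sgraph 'I_n} :=
  finset (fun G : sgraph 'I_n => `[< claw_free G >]).

(* Point mass of G(n, p): each pair is indexed once, as i < j, and the factors
   are multiplied because the edges are independent. *)
Definition gnp (R : realType) (n : nat) (p : R) (G : sgraph 'I_n) : R :=
  \prod_(i < n) \prod_(j < n | (i < j)%N) bernoulli_pmf p (adj G i j).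

Definition gnp_prob (R : realType) (n : nat) (p : R)
    (A : {set sgraph 'I_n}) : R :=
  \sum_(G in A) gnp p G.

Definition log2 (R : realType) (x : R) : R := ln x / ln 2.

Definition r_star (R : realType) (p : R) : R :=
  if p < (3 - Num.sqrt 5) / 2 then - log2 (1 - p) else - (1 / 2) * log2 p.

(* Main.v *)
(* Lower bound: the empty graph, and any graph containing two disjoint cliques
   that cover the vertices, are claw-free.

   Upper bound: apply Szemerédi's regularity lemma to a claw-free graph and call
   a pair of cells low, high or grey according to whether its edge density is
   close to 0, close to 1, or neither.  Counting in regular pairs gives two
   kinds of claws.  If a cell has a grey neighbour then it contains a positive
   density of edges, otherwise three independent leaves in it could be joined to
   a centre in the neighbour.  Consequently two grey neighbours of the same cell
   form a high pair, otherwise there is a claw whose centre and one leaf lie in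
   that cell.  A symmetric relation [M] whose square is supported on [J] has at
   most as many pairs as [J], so there are at most as many grey pairs as high
   ones, up to a negligible error, and #low + 2 #high >= (1 - o(1)) n^2 (ordered pairs of
   vertices).  The
   number of partitions and labellings is 2^o(n^2); for a fixed one, an
   exponential moment bounds the probability by
   (1 - p)^(#low / 2) p^(#high / 2) 2^o(n^2), which is at most
   max(1 - p, sqrt p)^((1 - o(1)) n^2 / 2). *)
Require Import Defs.
From mathcomp Require Import all_boot all_order all_algebra.
From mathcomp Require Import all_classical all_reals all_analysis.
From mathcomp Require Import fintype finset.
From mathcomp Require Import ring lra.
Import Order.TTheory GRing.Theory Num.Theory.
Import numFieldNormedType.Exports.

Set Implicit Arguments.
Unset Strict Implicit.
Unset Printing Implicit Defensive.

Local Open Scope ring_scope.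

(** * Szemerédi's regularity lemma *)

Lemma sum_const2 (R : realFieldType) (V W : finType) (A : {pred V})
    (B : {pred W}) (k : R) :
  \sum_(x in A) \sum_(y in B) k = k * (#|A|%:R * #|B|%:R).
Proof.
under eq_bigr do rewrite sumr_const.
by rewrite sumr_const -mulrnA -[LHS]mulr_natr natrM [#|B|%:R * _]mulrC.
Qed.

Section Cells.
Variables (R : realFieldType) (V L : finType) (f : V -> V -> R) (c : V -> L).

Definition cell (i : L) : {set V} := [set x | c x == i].

Definition density (i j : L) : R :=
  (\sum_(x in cell i) \sum_(y in cell j) f x y) /
  (#|cell i|%:R * #|cell j|%:R).

Lemma sum_cells (F : V -> V -> R) :
  \sum_x \sum_y F x y =
  \sum_i \sum_j \sum_(x in cell i) \sum_(y in cell j) F x y.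
Proof.
rewrite (partition_big c predT) //=; apply: eq_bigr => i _.
transitivity (\sum_(x in cell i) \sum_j \sum_(y in cell j) F x y).
  apply: eq_big => [x|x _]; first by rewrite inE.
  rewrite (partition_big c predT) //=; apply: eq_bigr => j _.
  by apply: eq_bigl => y; rewrite inE.
by rewrite exchange_big.
Qed.

Lemma mem_cell x : x \in cell (c x). Proof. by rewrite inE. Qed.

Lemma card_cell_gt0 x : 0 < #|cell (c x)|%:R :> R.
Proof. by rewrite ltr0n; apply/card_gt0P; exists x; rewrite mem_cell. Qed.

Lemma sum_block i j :
  \sum_(x in cell i) \sum_(y in cell j) f x y =
  density i j * (#|cell i|%:R * #|cell j|%:R).
Proof.
(* With an empty cell both sides are 0, whatever value the division by 0 gives [density]. *)
have [i0|/set0Pn[x xi]] := eqVneq (cell i) set0.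
  by rewrite i0 big_set0 cards0 mul0r mulr0.
have [j0|/set0Pn[y yj]] := eqVneq (cell j) set0.
  by rewrite j0 cards0 !mulr0; apply: big1 => z _; rewrite big_set0.
move: xi yj; rewrite !inE => /eqP <- /eqP <-.
rewrite divfK // mulf_neq0 ?gt_eqF ?card_cell_gt0 //.
Qed.

(** Block averaging is an orthogonal projection: against a function constant on blocks, [f] may be
    replaced by its averages. *)
Lemma sum_density (g : L -> L -> R) :
  \sum_x \sum_y f x y * g (c x) (c y) =
  \sum_x \sum_y density (c x) (c y) * g (c x) (c y).
Proof.
rewrite !sum_cells; apply: eq_bigr => i _; apply: eq_bigr => j _.
transitivity (\sum_(x in cell i) \sum_(y in cell j) f x y * g i j).
  apply: eq_bigr => x; rewrite inE => /eqP->.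
  by apply: eq_bigr => y; rewrite inE => /eqP->.
transitivity (\sum_(x in cell i) \sum_(y in cell j) density i j * g i j).
  under eq_bigr do rewrite -mulr_suml.
  rewrite -[LHS]mulr_suml sum_block.
  by rewrite sum_const2; ring.
apply: eq_bigr => x; rewrite inE => /eqP->.
by apply: eq_bigr => y; rewrite inE => /eqP->.
Qed.

(** The unnormalised index of the partition: the squared L2 norm of the block averages of [f]. *)
Definition energy : R := \sum_x \sum_y density (c x) (c y) ^+ 2.

(* Expand [0 <= \sum (density - h) ^+ 2] and apply [sum_density]. *)
Lemma energy_ge (h : L -> L -> R) :
  \sum_x \sum_y (2 * f x y - h (c x) (c y)) * h (c x) (c y) <= energy.
Proof.
rewrite -subr_ge0.
have -> : energy - \sum_x \sum_y (2 * f x y - h (c x) (c y)) * h (c x) (c y)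
        = \sum_x \sum_y (density (c x) (c y) - h (c x) (c y)) ^+ 2.
  have E : \sum_x \sum_y (2 * f x y - h (c x) (c y)) * h (c x) (c y) =
    \sum_x \sum_y (2 * density (c x) (c y) - h (c x) (c y)) * h (c x) (c y).
    have D (k : V -> V -> R) :
        \sum_x \sum_y (2 * k x y - h (c x) (c y)) * h (c x) (c y) =
        2 * (\sum_x \sum_y k x y * h (c x) (c y))
        - \sum_x \sum_y h (c x) (c y) ^+ 2.
      rewrite mulr_sumr -sumrB; apply: eq_bigr => x _.
      rewrite mulr_sumr -sumrB; apply: eq_bigr => y _.
      ring.
    by rewrite (D f) (D (fun x y => density (c x) (c y))) sum_density.
  rewrite E -sumrB; apply: eq_bigr => x _; rewrite -sumrB.
  by apply: eq_bigr => y _; ring.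
by apply: sumr_ge0 => x _; apply: sumr_ge0 => y _; apply: sqr_ge0.
Qed.

Lemma energy_density :
  \sum_x \sum_y (2 * f x y - density (c x) (c y)) * density (c x) (c y)
  = energy.
Proof.
have D (k : V -> V -> R) :
    \sum_x \sum_y (2 * k x y - density (c x) (c y)) * density (c x) (c y) =
    2 * (\sum_x \sum_y k x y * density (c x) (c y)) - energy.
  rewrite mulr_sumr -sumrB; apply: eq_bigr => x _.
  rewrite mulr_sumr -sumrB; apply: eq_bigr => y _.
  ring.
rewrite D sum_density.
have -> : \sum_x \sum_y density (c x) (c y) * density (c x) (c y) = energy.
  by apply: eq_bigr => x _; apply: eq_bigr => y _; rewrite expr2.
by ring.
Qed.

Hypothesis f01 : forall x y, 0 <= f x y <= 1.

Lemma density_itv i j : 0 <= density i j <= 1.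
Proof.
apply/andP; split.
  by rewrite divr_ge0 ?mulr_ge0 ?ler0n // sumr_ge0 // => x _;
     rewrite sumr_ge0 // => y _; case/andP: (f01 x y).
have [/eqP z|/negbTE nz] := boolP (#|cell i|%:R * #|cell j|%:R == 0 :> R).
  by rewrite /density z invr0 mulr0 ler01.
have pos : 0 < #|cell i|%:R * #|cell j|%:R :> R.
  by rewrite lt_neqAle eq_sym nz mulr_ge0 ?ler0n.
rewrite ler_pdivrMr // mul1r.
have -> : #|cell i|%:R * #|cell j|%:R =
    \sum_(x in cell i) \sum_(y in cell j) (1 : R).
  by rewrite sum_const2 mul1r.
by apply: ler_sum => x _; apply: ler_sum => y _; case/andP: (f01 x y).
Qed.

Lemma energy_le : energy <= #|V|%:R ^+ 2.
Proof.
have -> : #|V|%:R ^+ 2 = \sum_(x : V) \sum_(y : V) (1 : R).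
  by rewrite sum_const2 mul1r expr2.
apply: ler_sum => x _; apply: ler_sum => y _.
by have /andP[? ?] := density_itv (c x) (c y); rewrite expr_le1.
Qed.

(** Regularity is taken in cut-norm form: the deviation on [X] and [Y], cut down to the two cells,
    is compared in [irregular] with [eps] times the size of the whole block. *)
Definition discrepancy (i j : L) (X Y : {set V}) : R :=
  \sum_(x in cell i) \sum_(y in cell j)
     (f x y - density i j) * ((x \in X)%:R * (y \in Y)%:R).

Definition irregular (eps : R) (i j : L) : bool :=
  [exists XY : {set V} * {set V},
     eps * (#|cell i|%:R * #|cell j|%:R) < `|discrepancy i j XY.1 XY.2|].

Definition witness eps i j : {set V} * {set V} :=
  odflt (set0, set0) [pick XY : {set V} * {set V} |
     eps * (#|cell i|%:R * #|cell j|%:R) < `|discrepancy i j XY.1 XY.2|].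

(** The first set records [x] as a row vertex, the second as a column vertex. The label type depends
    on [L] alone, so the number of labels is bounded independently of [V]. *)
Definition refine eps (x : V) : L * {set L} * {set L} :=
  (c x, [set j | x \in (witness eps (c x) j).1],
        [set j | x \in (witness eps j (c x)).2]).

Lemma witness_discrepancy eps i j : irregular eps i j ->
  eps * (#|cell i|%:R * #|cell j|%:R) <
  `|discrepancy i j (witness eps i j).1 (witness eps i j).2|.
Proof.
move=> irr; rewrite /witness; case: pickP => [XY //|noXY] /=.
by case/existsP: irr => XY; rewrite noXY.
Qed.
End Cells.

Section Increment.
Variables (R : realFieldType) (V L : finType) (f : V -> V -> R) (c : V -> L).
Variables (eps : R) (eps_ge0 : 0 <= eps).
Let wit := witness f c eps.
Let d := density f c.
Let disc i j := discrepancy f c i j (wit i j).1 (wit i j).2.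
Let s (x y : V) : R :=
  if irregular f c eps (c x) (c y) then
    Num.sg (disc (c x) (c y)) *
    ((x \in (wit (c x) (c y)).1)%:R * (y \in (wit (c x) (c y)).2)%:R)
  else 0.

(* [energy_ge] for the refined partition, applied to the old density corrected
   by [eps] times the sign of the discrepancy on each witness rectangle. *)
Lemma energy_refine :
  energy f c + eps ^+ 2 * (\sum_x \sum_y (irregular f c eps (c x) (c y))%:R)
  <= energy f (refine f c eps).
Proof.
(* The tests [j \in A] and [i \in B] read the witness memberships off the labels, so the corrected
   density is a function of the refined labels. *)
pose h (l l' : L * {set L} * {set L}) : R :=
  let: (i, A, _) := l in let: (j, _, B) := l' in
  d i j + eps * (if irregular f c eps i j then
     Num.sg (disc i j) * ((j \in A)%:R * (i \in B)%:R) else 0).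
have hE x y : h (refine f c eps x) (refine f c eps y)
    = d (c x) (c y) + eps * s x y.
  by rewrite /h /= !inE.
move: h hE => h hE.
apply: le_trans (energy_ge f (refine f c eps) h).
(* With [h = d + eps * s] the summand is [(2 f - d) d + 2 eps (f - d) s - eps^2 s^2], and the first
   term sums to the old energy. *)
rewrite [leRHS](_ : _ = energy f c +
    (2 * eps * (\sum_x \sum_y (f x y - d (c x) (c y)) * s x y)
     - eps ^+ 2 * \sum_x \sum_y s x y ^+ 2)); last first.
  rewrite -energy_density !mulr_sumr -sumrB -big_split /=.
  apply: eq_bigr => x _; rewrite !mulr_sumr -sumrB -big_split /=.
  by apply: eq_bigr => y _; rewrite hE /d; ring.
rewrite lerD2l.
set N := \sum_x \sum_y _%:R.
have s2 : \sum_x \sum_y s x y ^+ 2 <= N.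
  apply: ler_sum => x _; apply: ler_sum => y _; rewrite /s.
  case: ifP => _; last by rewrite expr0n.
  rewrite -[leLHS]ger0_norm ?sqr_ge0 // normrX normrM normrM !normr_nat.
  rewrite expr_le1 // ?mulr_ge0 // mulr_ile1 ?mulr_ge0 //.
    by rewrite normr_sg; case: (_ != 0).
  by rewrite mulr_ile1 //; case: (_ \in _).
(* On an irregular block the sign produces the absolute discrepancy, which exceeds [eps] times the
   block. The gain [2 eps^2 N] less the loss [eps^2 N] leaves [eps^2 N]. *)
have fs : eps * N <= \sum_x \sum_y (f x y - d (c x) (c y)) * s x y.
  rewrite /N !(sum_cells c) mulr_sumr; apply: ler_sum => i _.
  rewrite mulr_sumr; apply: ler_sum => j _.
  have -> : \sum_(x in cell c i) \sum_(y in cell c j)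
      (irregular f c eps (c x) (c y))%:R =
     (irregular f c eps i j)%:R * (#|cell c i|%:R * #|cell c j|%:R) :> R.
    transitivity (\sum_(x in cell c i) \sum_(y in cell c j)
        (irregular f c eps i j)%:R : R).
      apply: eq_bigr => x; rewrite inE => /eqP->.
      by apply: eq_bigr => y; rewrite inE => /eqP->.
    exact: sum_const2.
  have -> : \sum_(x in cell c i) \sum_(y in cell c j)
      (f x y - d (c x) (c y)) * s x y =
     (irregular f c eps i j)%:R * `|disc i j|.
    rewrite [in RHS]normrEsg /disc /discrepancy !mulr_sumr; apply: eq_bigr => x.
    rewrite inE => /eqP xi; rewrite !mulr_sumr; apply: eq_bigr => y.
    rewrite inE /s => /eqP yj; rewrite xi yj -/d.
    case: ifP => _ /=; last by rewrite !mul0r mulr0.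
    by rewrite mul1r mulrCA.
  case: (boolP (irregular f c eps i j)) => [irr|_]; last by rewrite !mul0r mulr0.
  by rewrite !mul1r ltW // witness_discrepancy.
have := ler_wpM2l eps_ge0 fs.
have := ler_wpM2l (sqr_ge0 eps) s2.
rewrite expr2; set P := \sum_x _ ; set Q := \sum_x _.
by nra.
Qed.
End Increment.

(* The refined label of a vertex records its cell and, for every other cell,
   on which side of the two witness sets the vertex lies. *)
Fixpoint labels (N m : nat) : finType :=
  if m is m'.+1 then (labels N m' * {set labels N m'} * {set labels N m'})%type
  else 'I_N.

Lemma exists_nat_gt (R : realType) (x : R) : exists n : nat, x < n%:R.
Proof.
exists (Num.bound `|x|).
exact: le_lt_trans (ler_norm x) (archi_boundP (normr_ge0 x)).
Qed.

(** Energy increment: refining a partition with too many irregular pairs gains at least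
    [eps^2 delta n^2], while the energy never exceeds [n^2]. The process starts from the residues
    modulo [N.+1], which refinement preserves; this keeps the cells small, so that few pairs lie
    inside a cell. *)
Theorem regularity_lemma (R : realType) (eps delta : R) (N : nat) :
  0 < eps -> 0 < delta -> exists M : nat,
  forall (n : nat) (f : 'I_n -> 'I_n -> R), (forall x y, 0 <= f x y <= 1) ->
  exists m : nat, exists c : 'I_n -> labels N.+1 m,
   [/\ (m < M)%N,
       forall x y, c x = c y -> x = y %[mod N.+1] &
       \sum_x \sum_y (irregular f c eps (c x) (c y))%:R <= delta * n%:R ^+ 2].
Proof.
move=> e0 d0.
have g0 : 0 < eps ^+ 2 * delta by rewrite mulr_gt0 ?exprn_gt0.
have [M MP] := exists_nat_gt (eps ^+ 2 * delta)^-1.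
exists M.+1 => n f f01; case: n f f01 => [|n] f f01.
  exists 0, (fun _ => ord0); split=> //.
    by case.
  by rewrite big_ord0 expr0n mulr0.
(* Either a good partition appears after fewer than [k] refinements, or the [k]-th one has gained
   [k] increments of energy. *)
have main k : (exists m, exists c : 'I_n.+1 -> labels N.+1 m,
   [/\ (m < k)%N, forall x y, c x = c y -> x = y %[mod N.+1] &
     \sum_x \sum_y (irregular f c eps (c x) (c y))%:R <= delta * n.+1%:R ^+ 2])
  \/ exists c : 'I_n.+1 -> labels N.+1 k,
   (forall x y, c x = c y -> x = y %[mod N.+1]) /\
   k%:R * (eps ^+ 2 * delta * n.+1%:R ^+ 2) <= energy f c.
  elim: k => [|k [[m [c [mk cN cI]]]|[c [cN cE]]]].
  - right; exists (fun x => inord (x %% N.+1)); split.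
      move=> x y /(congr1 val); rewrite /= !inordK ?ltn_pmod //.
    rewrite mul0r; apply: sumr_ge0 => x _; apply: sumr_ge0 => y _.
    exact: sqr_ge0.
  - by left; exists m, c; split=> //; apply: ltnW.
  have [good|bad] := leP (\sum_x \sum_y (irregular f c eps (c x) (c y))%:R)
                       (delta * n.+1%:R ^+ 2).
    by left; exists k, c; split.
  right; exists (refine f c eps); split.
    by move=> x y [/cN].
  apply: le_trans (energy_refine f c (ltW e0)).
  rewrite -natr1 mulrDl mul1r lerD // -mulrA ler_wpM2l ?sqr_ge0 //.
  exact: ltW.
have [[m [c P]]|[c [cN cE]]] := main M.+1; first by exists m, c.
have := le_trans cE (energy_le _ f01); rewrite card_ord mulrA.
rewrite -[leRHS]mul1r ler_pM2r ?exprn_gt0 ?ltr0n // => contra.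
have : 1 < M.+1%:R * (eps ^+ 2 * delta).
  rewrite -ltr_pdivrMr // mul1r (lt_trans MP) // ltr_nat //.
by rewrite ltNge contra.
Qed.

(** * Combinatorial counting *)

(* With [d] the degree in [M], each term of [\sum_(M x y) d y / d x] is paired
   with its inverse, so this sum is at least the number of pairs in [M]; and
   [d y <= #|J x|] whenever [M x y]. *)
Lemma sum_pairs_le (R : realFieldType) (V : finType) (M J : rel V) :
  symmetric M -> (forall x y z, M x y -> M x z -> J y z) ->
  \sum_x \sum_y (M x y)%:R <= \sum_x \sum_y (J x y)%:R :> R.
Proof.
move=> symM MJ; pose d x : R := \sum_y (M x y)%:R.
have d0 x : 0 <= d x by apply: sumr_ge0 => y _; rewrite ler0n.
have dpos x y : M x y -> 0 < d x.
  move=> Mxy; rewrite /d (bigD1 y) //= Mxy ltr_pwDl //.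
  by apply: sumr_ge0 => z _; rewrite ler0n.
have half : \sum_x \sum_y (M x y)%:R <= \sum_x \sum_y (M x y)%:R * (d y / d x).
  have twice (a : R) : 2 * a = a + a by ring.
  rewrite -(ler_pM2l (_ : 0 < 2)) // !twice.
  rewrite [X in _ <= _ + X]exchange_big -!big_split /=.
  apply: ler_sum => x _; rewrite -!big_split /=; apply: ler_sum => y _.
  rewrite [M y x]symM; case: (boolP (M x y)) => [Mxy|_]; last by rewrite !mul0r addr0.
  rewrite !mul1r; have dx := dpos _ _ Mxy.
  have dy : 0 < d y by apply: (dpos y x); rewrite symM.
  rewrite addf_div ?gt_eqF // ler_pdivlMr ?mulr_gt0 //.
  by have := sqr_ge0 (d x - d y); rewrite /= expr2; nra.
apply: le_trans half _; apply: ler_sum => x _.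
have bound y : (M x y)%:R * (d y / d x) <=
    (M x y)%:R * ((\sum_z (J x z)%:R) / d x).
  case: (boolP (M x y)) => [Mxy|_]; last by rewrite !mul0r.
  rewrite ler_wpM2l // ler_wpM2r ?invr_ge0 //.
  apply: ler_sum => z _; rewrite ler_nat.
  case: (boolP (M y z)) => // Myz.
  by rewrite (MJ y x z) // symM.
apply: le_trans (ler_sum _ (fun y _ => bound y)) _.
rewrite -mulr_suml -/(d x).
have [->|dx] := eqVneq (d x) 0.
  by rewrite mul0r; apply: sumr_ge0 => y _; rewrite ler0n.
by rewrite mulrC divfK.
Qed.

(** * Counting with weights in regular pairs *)

Section Uniform.
Variables (R : realFieldType) (V : finType).
Implicit Types (A B C : {set V}) (g : V -> V -> R) (u v : V -> R).

(** A bilinear form on weights between 0 and 1 is largest at 0/1 weights: round [u] to the set where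
    its coefficient is nonnegative, then [v] likewise. *)
Lemma sum_indicator_le A B (T : V -> V -> R) (b : R) :
  (forall X Y : {set V},
     \sum_(x in A) \sum_(y in B) T x y * ((x \in X)%:R * (y \in Y)%:R) <= b) ->
  forall u v, (forall x, 0 <= u x <= 1) -> (forall y, 0 <= v y <= 1) ->
  \sum_(x in A) \sum_(y in B) T x y * (u x * v y) <= b.
Proof.
have clip (D : {set V}) (w : V -> R) (t : V -> R) :
    (forall x, 0 <= w x <= 1) ->
    \sum_(x in D) t x * w x <= \sum_(x in D) t x * (x \in [set z | 0 <= t z])%:R.
  move=> w01; apply: ler_sum => x _; rewrite inE.
  have /andP[w0 w1] := w01 x; case: (lerP 0 (t x)) => t0 /=; first by nra.
  by nra.
move=> bX u v u01 v01.
pose X := [set x | 0 <= \sum_(y in B) T x y * v y].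
apply: le_trans
  (_ : \sum_(x in A) (\sum_(y in B) T x y * v y) * (x \in X)%:R <= _).
  have -> : \sum_(x in A) \sum_(y in B) T x y * (u x * v y) =
            \sum_(x in A) (\sum_(y in B) T x y * v y) * u x.
    apply: eq_bigr => x _; rewrite mulr_suml; apply: eq_bigr => y _.
    by ring.
  exact: clip.
pose Y := [set y | 0 <= \sum_(x in A) T x y * (x \in X)%:R].
apply: le_trans (bX X Y).
have -> : \sum_(x in A) (\sum_(y in B) T x y * v y) * (x \in X)%:R =
          \sum_(y in B) (\sum_(x in A) T x y * (x \in X)%:R) * v y.
  under eq_bigr do rewrite mulr_suml.
  rewrite exchange_big /=; apply: eq_bigr => y _; rewrite mulr_suml.
  by apply: eq_bigr => x _; rewrite mulrAC.
apply: le_trans (clip _ _ _ v01) _.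
rewrite exchange_big /=; apply: ler_sum => y _; rewrite mulr_suml.
by apply: ler_sum => x _; rewrite mulrA.
Qed.

(** A one-sided notion suffices, since edges and nonedges are both counted from below, the latter
    through [1 - f]. *)
Definition lower_uniform (eps eta : R) g A B : Prop :=
  forall u v, (forall x, 0 <= u x <= 1) -> (forall y, 0 <= v y <= 1) ->
  eta * (\sum_(x in A) \sum_(y in B) u x * v y) - eps * (#|A|%:R * #|B|%:R)
  <= \sum_(x in A) \sum_(y in B) g x y * (u x * v y).

(** Rounding passes from sets to weights, and [rho] may be lowered to [eta] because the total weight
    is nonnegative. *)
Lemma lower_uniform_of_discrepancy (eps eta rho : R) g A B :
  eta <= rho ->
  (forall X Y : {set V}, `| \sum_(x in A) \sum_(y in B)
      (g x y - rho) * ((x \in X)%:R * (y \in Y)%:R) | <=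
      eps * (#|A|%:R * #|B|%:R)) ->
  lower_uniform eps eta g A B.
Proof.
move=> er disc u v u01 v01.
have := @sum_indicator_le A B (fun x y => rho - g x y)
  (eps * (#|A|%:R * #|B|%:R)) _ u v u01 v01.
have opp w z : \sum_(x in A) \sum_(y in B) (rho - g x y) * (w x * z y) =
   - \sum_(x in A) \sum_(y in B) (g x y - rho) * (w x * z y) :> R.
  rewrite -sumrN; apply: eq_bigr => x _; rewrite -sumrN.
  by apply: eq_bigr => y _; rewrite -mulNr opprB.
have side (X Y : {set V}) : \sum_(x in A) \sum_(y in B)
    (rho - g x y) * ((x \in X)%:R * (y \in Y)%:R) <= eps * (#|A|%:R * #|B|%:R).
  rewrite (opp (fun x => (x \in X)%:R) (fun y => (y \in Y)%:R)).
  by apply: le_trans (disc X Y); rewrite -normrN ler_norm.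
move=> /(_ side); rewrite opp; set s := \sum_(x in A) _.
have -> : s = \sum_(x in A) \sum_(y in B) g x y * (u x * v y) -
              rho * \sum_(x in A) \sum_(y in B) u x * v y.
  rewrite /s mulr_sumr -sumrB; apply: eq_bigr => x _.
  by rewrite mulr_sumr -sumrB; apply: eq_bigr => y _; rewrite mulrBl.
have uv0 : 0 <= \sum_(x in A) \sum_(y in B) u x * v y.
  apply: sumr_ge0 => x _; apply: sumr_ge0 => y _.
  by have /andP[? _] := u01 x; have /andP[? _] := v01 y; rewrite mulr_ge0.
move: uv0 er; set P := \sum_(x in A) _; set Q := \sum_(x in A) _; nra.
Qed.

Definition sum4 (A B C D : {set V}) (F : V -> V -> V -> V -> R) : R :=
  \sum_(x in A) \sum_(y in B) \sum_(z in C) \sum_(t in D) F x y z t.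

Lemma sum4C12 A B C D F :
  sum4 A B C D F = sum4 B A C D (fun y x z t => F x y z t).
Proof. exact: exchange_big. Qed.

Lemma sum4C23 A B C D F :
  sum4 A B C D F = sum4 A C B D (fun x z y t => F x y z t).
Proof. by apply: eq_bigr => x _; apply: exchange_big. Qed.

Lemma sum4C34 A B C D F :
  sum4 A B C D F = sum4 A B D C (fun x y t z => F x y z t).
Proof. by apply: eq_bigr => x _; apply: eq_bigr => y _; apply: exchange_big. Qed.

(** For fixed [x] and [y] the factors already present do not join [z] to [t]; they split into a
    weight on [C] and one on [D], so the new factor [g z t] can be inserted. *)
Lemma lower_uniform_sum4 (eps eta : R) g A B C D (u v : V -> V -> V -> R) F :
  (forall x y z t, F x y z t = u x y z * v x y t) ->
  lower_uniform eps eta g C D ->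
  (forall x y z, 0 <= u x y z <= 1) -> (forall x y t, 0 <= v x y t <= 1) ->
  eta * sum4 A B C D F
    - eps * (#|A|%:R * #|B|%:R * #|C|%:R * #|D|%:R)
  <= sum4 A B C D (fun x y z t => g z t * F x y z t).
Proof.
move=> FE lu u01 v01.
have -> : eps * (#|A|%:R * #|B|%:R * #|C|%:R * #|D|%:R) =
  \sum_(x in A) \sum_(y in B) (eps * (#|C|%:R * #|D|%:R)).
  by rewrite sum_const2; ring.
rewrite /sum4 mulr_sumr -sumrB; apply: ler_sum => x _.
rewrite mulr_sumr -sumrB; apply: ler_sum => y _.
have := lu (u x y) (v x y) (u01 x y) (v01 x y).
have -> : \sum_(z in C) \sum_(t in D) F x y z t =
          \sum_(z in C) \sum_(t in D) u x y z * v x y t.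
  by apply: eq_bigr => z _; apply: eq_bigr => t _; rewrite FE.
have -> // : \sum_(z in C) \sum_(t in D) g z t * F x y z t =
          \sum_(z in C) \sum_(t in D) g z t * (u x y z * v x y t).
by apply: eq_bigr => z _; apply: eq_bigr => t _; rewrite FE.
Qed.
End Uniform.

Section Counting.
Variables (R : realFieldType) (V : finType) (eps eta : R).
Hypotheses (eps_ge0 : 0 <= eps) (eta_itv : 0 <= eta <= 1).
Implicit Types (A B C : {set V}) (g : V -> V -> R).

Let unit_itv g := forall x y, 0 <= g x y <= 1.

Lemma itvM (a b : R) : 0 <= a <= 1 -> 0 <= b <= 1 -> 0 <= a * b <= 1.
Proof. by move=> /andP[? ?] /andP[? ?]; rewrite mulr_ge0 //= mulr_ile1. Qed.

Lemma itv1 : 0 <= (1 : R) <= 1. Proof. by rewrite ler01 lexx. Qed.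

(** As [eta <= 1], the errors inherited from earlier insertions do not grow, so each insertion adds
    at most one [e]. *)
Lemma lower_bound_step (k : R) (s t p e : R) :
  0 <= e -> eta * t - e <= s -> p - k * e <= t -> 0 <= k ->
  eta * p - (k + 1) * e <= s.
Proof.
move=> e0 ts pt k0; have /andP[h0 h1] := eta_itv.
have : eta * (p - k * e) <= eta * t by rewrite ler_wpM2l.
have : eta * (k * e) <= k * e by rewrite ler_piMl // mulr_ge0.
by lra.
Qed.

Lemma sum4_const A B C D (F : V -> V -> R) :
  sum4 A B C D (fun x y _ _ => F x y) =
  (\sum_(x in A) \sum_(y in B) F x y) * (#|C|%:R * #|D|%:R).
Proof.
rewrite /sum4 mulr_suml; apply: eq_bigr => x _; rewrite mulr_suml.
by apply: eq_bigr => y _; rewrite sum_const2.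
Qed.

(** The three edges to the centre [b] are inserted one at a time; permuting the sums puts the
    current leaf next to [b], and [h] weighs the triple of leaves. *)
Lemma count_star A B g (h : V -> V -> V -> R) :
  unit_itv g -> (forall x y z, 0 <= h x y z <= 1) ->
  lower_uniform eps eta g A B ->
  eta ^+ 3 * (#|B|%:R * \sum_(x in A) \sum_(y in A) \sum_(z in A) h x y z)
    - 3 * (eps * (#|A|%:R * #|A|%:R * #|A|%:R * #|B|%:R))
  <= sum4 A A A B (fun x y z b => g z b * (g y b * (g x b * h x y z))).
Proof.
move=> g01 h01 lu.
set E := eps * _; have E0 : 0 <= E by rewrite /E !mulr_ge0 ?ler0n.
pose T0 := sum4 A A A B (fun x y z b => h x y z).
pose T1 := sum4 A A A B (fun x y z b => g x b * h x y z).
pose T2 := sum4 A A A B (fun x y z b => g y b * (g x b * h x y z)).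
have S0 : T0 = #|B|%:R * \sum_(x in A) \sum_(y in A) \sum_(z in A) h x y z.
  rewrite /T0 /sum4 mulr_sumr; apply: eq_bigr => x _.
  rewrite mulr_sumr; apply: eq_bigr => y _.
  rewrite mulr_sumr; apply: eq_bigr => z _.
  by rewrite sumr_const mulr_natl.
have S1 : eta * T0 - E <= T1.
  have r F : sum4 A A A B F = sum4 A A A B (fun y z x b => F x y z b).
    by rewrite [LHS]sum4C12 [LHS]sum4C23.
  rewrite /T0 /T1 [sum4 _ _ _ _ _ in leLHS]r [leRHS]r.
  apply: (@lower_uniform_sum4 _ _ _ _ _ _ _ _ _
            (fun y z x => h x y z)
            (fun _ _ _ => 1)) => //; last by move=> *; apply: itv1.
  by move=> *; rewrite mulr1.
have S2 : eta * T1 - E <= T2.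
  rewrite /T1 /T2 [sum4 _ _ _ _ _ in leLHS]sum4C23 [leRHS]sum4C23.
  apply: (@lower_uniform_sum4 _ _ _ _ _ _ _ _ _
            (fun x z y => h x y z)
            (fun x _ b => g x b)) => // *; exact: mulrC.
have S3 : eta * T2 - E <=
    sum4 A A A B (fun x y z b => g z b * (g y b * (g x b * h x y z))).
  apply: (@lower_uniform_sum4 _ _ _ _ _ _ _ _ _
            (fun x y z => h x y z)
            (fun x y b => g y b * g x b)) => // *.
    by rewrite mulrA mulrC.
  by apply: itvM.
have Q0 : T0 - 0 * E <= T0 by rewrite mul0r subr0.
have Q1 := lower_bound_step E0 S1 Q0 (lexx 0).
have Q2 := lower_bound_step E0 S2 Q1 (ltac:(lra)).
have := lower_bound_step E0 S3 Q2 (ltac:(lra)).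
rewrite -S0 !exprS expr0 mulr1 -!mulrA.
by have -> : 0 + 1 + 1 + 1 = 3 :> R by lra.
Qed.

(** The pairs between cells are inserted in the order [g1] to [g5]; [g0] is carried along as a
    weight inside [A], and only its total enters the bound. *)
Lemma count_two_cells A B C (g0 g1 g2 g3 g4 g5 : V -> V -> R) :
  unit_itv g0 -> unit_itv g1 -> unit_itv g2 -> unit_itv g3 -> unit_itv g4 ->
  lower_uniform eps eta g1 A B -> lower_uniform eps eta g2 A B ->
  lower_uniform eps eta g3 A C -> lower_uniform eps eta g4 A C ->
  lower_uniform eps eta g5 B C ->
  eta ^+ 5 * ((\sum_(x in A) \sum_(x' in A) g0 x x') * (#|B|%:R * #|C|%:R))
    - 5 * (eps * (#|A|%:R * #|A|%:R * #|B|%:R * #|C|%:R))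
  <= sum4 A A B C (fun x x' y z => g5 y z * (g4 x' z * (g3 x z *
        (g2 x' y * (g1 x y * g0 x x'))))).
Proof.
move=> i0 i1 i2 i3 i4 l1 l2 l3 l4 l5.
set E := eps * _; have E0 : 0 <= E by rewrite /E !mulr_ge0 ?ler0n.
pose T0 := sum4 A A B C (fun x x' y z => g0 x x').
pose T1 := sum4 A A B C (fun x x' y z => g1 x y * g0 x x').
pose T2 := sum4 A A B C (fun x x' y z => g2 x' y * (g1 x y * g0 x x')).
pose T3 := sum4 A A B C
  (fun x x' y z => g3 x z * (g2 x' y * (g1 x y * g0 x x'))).
pose T4 := sum4 A A B C
  (fun x x' y z => g4 x' z * (g3 x z * (g2 x' y * (g1 x y * g0 x x')))).
have S0 : T0 = (\sum_(x in A) \sum_(x' in A) g0 x x') * (#|B|%:R * #|C|%:R).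
  exact: sum4_const.
have S1 : eta * T0 - E <= T1.
  have -> : E = eps * (#|C|%:R * #|A|%:R * #|A|%:R * #|B|%:R).
    by rewrite /E; ring.
  have r F : sum4 A A B C F = sum4 C A A B (fun z x' x y => F x x' y z).
    by rewrite sum4C12 sum4C34 sum4C23 sum4C12.
  rewrite /T0 /T1 !r.
  apply: (@lower_uniform_sum4 _ _ _ _ _ _ _ _ _
            (fun z x' x => g0 x x')
            (fun _ _ _ => 1)) => //; last by move=> *; apply: itv1.
  by move=> *; rewrite mulr1.
have S2 : eta * T1 - E <= T2.
  have -> : E = eps * (#|C|%:R * #|A|%:R * #|A|%:R * #|B|%:R).
    by rewrite /E; ring.
  have r F : sum4 A A B C F = sum4 C A A B (fun z x x' y => F x x' y z).
    by rewrite sum4C34 sum4C23 sum4C12.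
  rewrite /T1 /T2 !r.
  by apply: (@lower_uniform_sum4 _ _ _ _ _ _ _ _ _
            (fun z x x' => g0 x x')
            (fun z x y => g1 x y)) => // *; rewrite mulrC.
have S3 : eta * T2 - E <= T3.
  have -> : E = eps * (#|A|%:R * #|B|%:R * #|A|%:R * #|C|%:R).
    by rewrite /E; ring.
  have r F : sum4 A A B C F = sum4 A B A C (fun x' y x z => F x x' y z).
    by rewrite sum4C12 sum4C23.
  rewrite /T2 /T3 !r.
  apply: (@lower_uniform_sum4 _ _ _ _ _ _ _ _ _
            (fun x' y x => g2 x' y * (g1 x y * g0 x x'))
            (fun _ _ _ => 1)) => // *; last exact: itv1.
    by rewrite mulr1.
  by do !apply: itvM.
have S4 : eta * T3 - E <= T4.
  have -> : E = eps * (#|A|%:R * #|B|%:R * #|A|%:R * #|C|%:R).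
    by rewrite /E; ring.
  have r F : sum4 A A B C F = sum4 A B A C (fun x y x' z => F x x' y z).
    by rewrite sum4C23.
  rewrite /T3 /T4 !r.
  apply: (@lower_uniform_sum4 _ _ _ _ _ _ _ _ _
            (fun x y x' => g2 x' y * (g1 x y * g0 x x'))
            (fun x _ z => g3 x z)) => // *; first by rewrite mulrC.
  by do !apply: itvM.
have S5 : eta * T4 - E <= sum4 A A B C (fun x x' y z =>
   g5 y z * (g4 x' z * (g3 x z * (g2 x' y * (g1 x y * g0 x x'))))).
  apply: (@lower_uniform_sum4 _ _ _ _ _ _ _ _ _
            (fun x x' y => g2 x' y * (g1 x y * g0 x x'))
            (fun x x' z => g4 x' z * g3 x z)) => // *.
  - by rewrite mulrA mulrC.
  - by do !apply: itvM.
  - by do !apply: itvM.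
have Q0 : T0 - 0 * E <= T0 by rewrite mul0r subr0.
have Q1 := lower_bound_step E0 S1 Q0 (lexx 0).
have Q2 := lower_bound_step E0 S2 Q1 (ltac:(lra)).
have Q3 := lower_bound_step E0 S3 Q2 (ltac:(lra)).
have Q4 := lower_bound_step E0 S4 Q3 (ltac:(lra)).
have := lower_bound_step E0 S5 Q4 (ltac:(lra)).
rewrite -S0 !exprS expr0 mulr1 -!mulrA.
by have -> : 0 + 1 + 1 + 1 + 1 + 1 = 5 :> R by lra.
Qed.
End Counting.

(** Claw-freeness in terms of a centre and three distinct leaves; for graphs it agrees with
    [claw_free], by [claw_free_has_no_claw] and [has_no_claw_claw_free]. *)
Definition has_no_claw (V : finType) (e : rel V) : Prop :=
  forall x y1 y2 y3, uniq [:: y1; y2; y3] -> e x y1 -> e x y2 -> e x y3 ->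
  [|| e y1 y2, e y1 y3 | e y2 y3].

(** * The two kinds of claws *)

Section Claws.
Variables (R : realFieldType) (V : finType) (e : rel V) (eps eta : R).
Hypothesis sym_e : symmetric e.
Hypothesis no_claw : has_no_claw e.
Hypotheses (eps_ge0 : 0 <= eps) (eta_itv : 0 <= eta <= 1).
Implicit Types (A B C : {set V}).

Let f x y : R := (e x y)%:R.
Let f' x y : R := 1 - f x y.

Let f_itv x y : 0 <= f x y <= 1.
Proof. by rewrite /f ler0n lern1; case: (e x y). Qed.

Let f'_itv x y : 0 <= f' x y <= 1.
Proof. by rewrite /f' /f; case: (e x y); rewrite /= ?subrr ?subr0 ler01 lexx. Qed.

(** If [A] had fewer edges, at least half of its triples would be independent, and with centres in
    [B] they would give a count of at least [(eta^3 / 2 - 3 eps) a^3 b]. Without claws only triples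
    with a repeated vertex contribute, at most [3 a^2 b]; the first two hypotheses make these bounds
    incompatible. *)
Lemma leaf_cell_dense A B :
  24 * eps <= eta ^+ 3 -> 8 < eta ^+ 3 * #|A|%:R -> (0 < #|B|)%N ->
  lower_uniform eps eta f A B ->
  #|A|%:R ^+ 2 <= 6 * \sum_(x in A) \sum_(y in A) f x y.
Proof.
move=> eps_le A_big B0 lu.
set a : R := #|A|%:R; set b : R := #|B|%:R.
set S := \sum_(x in A) _.
have b0 : 0 < b by rewrite ltr0n.
have a0 : 0 < a.
  rewrite lt_def ler0n andbT; apply: contraTneq A_big => a_eq0.
  by rewrite -/a a_eq0 mulr0 -leNgt.
pose h x y z := f' x y * (f' x z * f' y z).
have h01 x y z : 0 <= h x y z <= 1 by do !apply: itvM.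
have low := count_star eps_ge0 eta_itv f_itv h01 lu.
have h_sum : a ^+ 3 - 3 * (a * S) <=
    \sum_(x in A) \sum_(y in A) \sum_(z in A) h x y z.
  (* Union bound over the three pairs of leaves. *)
  have h_ge x y z : 1 - f x y - f x z - f y z <= h x y z.
    rewrite /h /f' /f.
    by case: (e x y); case: (e x z); case: (e y z) => /=; lra.
  apply: le_trans (ler_sum _ (fun x _ => ler_sum _ (fun y _ =>
    ler_sum _ (fun z _ => h_ge x y z)))).
  have -> : \sum_(x in A) \sum_(y in A) \sum_(z in A)
      (1 - f x y - f x z - f y z) =
    \sum_(x in A) (\sum_(y in A) \sum_(z in A) 1
      - (\sum_(y in A) \sum_(z in A) f x y)
      - (\sum_(y in A) \sum_(z in A) f x z)
      - (\sum_(y in A) \sum_(z in A) f y z)).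
    apply: eq_bigr => x _; rewrite -!sumrB; apply: eq_bigr => y _.
    by rewrite -!sumrB.
  rewrite !sumrB.
  have -> : \sum_(x in A) \sum_(y in A) \sum_(z in A) 1 = a ^+ 3 :> R.
    under eq_bigr do rewrite sum_const2 mul1r.
    by rewrite sumr_const -mulr_natr /a; ring.
  have -> : \sum_(x in A) \sum_(y in A) \sum_(z in A) f x y = a * S.
    rewrite mulr_sumr; apply: eq_bigr => x _; rewrite mulr_sumr.
    by apply: eq_bigr => y _; rewrite sumr_const mulr_natl.
  have -> : \sum_(x in A) \sum_(y in A) \sum_(z in A) f x z = a * S.
    rewrite mulr_sumr; apply: eq_bigr => x _.
    by rewrite sumr_const mulr_natl.
  have -> : \sum_(x in A) \sum_(y in A) \sum_(z in A) f y z = a * S.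
    by rewrite sumr_const mulr_natl.
  by lra.
have up : sum4 A A A B (fun x y z t => f z t * (f y t * (f x t * h x y z)))
    <= 3 * (a ^+ 2 * b).
  (* Triples with a repeated leaf escape [has_no_claw], so they are bounded by the indicators of
     equality. *)
  have up1 x y z t : f z t * (f y t * (f x t * h x y z)) <=
      (x == y)%:R + (x == z)%:R + (y == z)%:R.
    have [xyz|] := boolP (uniq [:: x; y; z]); last first.
      have /andP[_ le1] : 0 <= f z t * (f y t * (f x t * h x y z)) <= 1.
        by do !apply: itvM.
      rewrite /= !inE andbT negb_and !negbK => /orP not_uniq.
      apply: le_trans le1 _; rewrite -!natrD ler1n.
      by case: not_uniq => [/orP[]|] ->; rewrite ?addn_gt0 ?orbT.
    suff -> : f z t * (f y t * (f x t * h x y z)) = 0.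
      by rewrite -!natrD ler0n.
    have := @no_claw t x y z xyz; rewrite ![e t _]sym_e /h /f' /f.
    case: (e x t); last by rewrite mul0r !mulr0.
    case: (e y t); last by rewrite mul0r !mulr0.
    case: (e z t); last by rewrite mul0r.
    move=> /(_ isT isT isT)/or3P[] ->; rewrite subrr ?mul0r ?mulr0 //.
  apply: le_trans (ler_sum _ (fun x _ => ler_sum _ (fun y _ => ler_sum _
    (fun z _ => ler_sum _ (fun t _ => up1 x y z t))))) _.
  have one x : x \in A -> \sum_(y in A) (x == y)%:R = 1 :> R.
    move=> xA; rewrite (bigD1 x) //= eqxx big1 ?addr0 // => y /andP[_].
    by rewrite eq_sym => /negbTE->.
  have -> : 3 * (a ^+ 2 * b) = (a ^+ 2 + a ^+ 2 + a ^+ 2) * b by ring.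
  have e1 : \sum_(x in A) \sum_(y in A) \sum_(z in A) (x == y)%:R = a ^+ 2.
    rewrite -[RHS]mul1r expr2 -sum_const2; apply: eq_bigr => x xA.
    by rewrite exchange_big; apply: eq_bigr => z _; rewrite one.
  have e2 : \sum_(x in A) \sum_(y in A) \sum_(z in A) (x == z)%:R = a ^+ 2.
    rewrite -[RHS]mul1r expr2 -sum_const2; apply: eq_bigr => x xA.
    by apply: eq_bigr => y _; rewrite one.
  have e3 : \sum_(x in A) \sum_(y in A) \sum_(z in A) (y == z)%:R = a ^+ 2.
    rewrite -[RHS]mul1r expr2 -sum_const2; apply: eq_bigr => x xA.
    by apply: eq_bigr => y yA; rewrite one.
  rewrite -{1}e1 -{1}e2 -e3 -!big_split /= mulr_suml; apply: ler_sum => x _.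
  rewrite -!big_split /= mulr_suml; apply: ler_sum => y _.
  rewrite -!big_split /= mulr_suml; apply: ler_sum => z _.
  by rewrite sumr_const -[leLHS]mulr_natr.
have := le_trans low up; rewrite -/a -/b => low'.
set H := \sum_(x in A) _ in low' h_sum.
have e3 : 0 <= eta ^+ 3 by rewrite exprn_ge0 //; case/andP: eta_itv.
rewrite leNgt; apply/negP => small.
have H_ge : a ^+ 3 / 2 <= H.
  apply: le_trans h_sum.
  have : a * (6 * S) <= a * a ^+ 2 by rewrite ler_pM2l // ltW.
  by rewrite -exprS; lra.
have k1 : eta ^+ 3 * (b * (a ^+ 3 / 2)) <= eta ^+ 3 * (b * H).
  by rewrite ler_wpM2l // ler_wpM2l // ltW.
have k2 : 24 * eps * (a * a * a * b) <= eta ^+ 3 * (a * a * a * b).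
  by rewrite ler_wpM2r // !mulr_ge0 // ltW.
have k3 : 8 * (a ^+ 2 * b) < eta ^+ 3 * a * (a ^+ 2 * b).
  by rewrite ltr_pM2r // mulr_gt0 // exprn_gt0.
by move: k1 k2 k3 low'; rewrite !exprS !expr0 !mulr1; lra.
Qed.

(** The claws counted have centre [x] and leaf [x'] in [A] and leaves [y] in [B], [z] in [C];
    disjointness makes the leaves distinct, so the count is 0. A dense [A] would make it at least
    [(eta^5 / 6 - 5 eps) a^2 b c], which is positive. *)
Lemma center_cell_sparse A B C :
  30 * eps < eta ^+ 5 ->
  (0 < #|A|)%N -> (0 < #|B|)%N -> (0 < #|C|)%N ->
  [disjoint A & B] -> [disjoint A & C] -> [disjoint B & C] ->
  lower_uniform eps eta f A B -> lower_uniform eps eta f' A B ->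
  lower_uniform eps eta f A C -> lower_uniform eps eta f' A C ->
  lower_uniform eps eta f' B C ->
  ~ #|A|%:R ^+ 2 <= 6 * \sum_(x in A) \sum_(y in A) f x y.
Proof.
move=> eps_lt A0 B0 C0 dAB dAC dBC lAB lAB' lAC lAC' lBC' dense.
have low := count_two_cells eps_ge0 eta_itv f_itv f_itv f'_itv f_itv f'_itv
  lAB lAB' lAC lAC' lBC'.
move: low; rewrite [X in _ <= X](_ : _ = 0); last first.
  rewrite /sum4; apply: big1 => x xA; apply: big1 => x' xA'.
  apply: big1 => y yB; apply: big1 => z zC.
  have x'y : x' != y by apply: contraTneq yB => <-; rewrite (disjointFr dAB).
  have x'z : x' != z by apply: contraTneq zC => <-; rewrite (disjointFr dAC).
  have yz : y != z by apply: contraTneq zC => <-; rewrite (disjointFr dBC).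
  have x'yz : uniq [:: x'; y; z] by rewrite /= !inE negb_or x'y x'z yz.
  have := no_claw (x := x) x'yz; rewrite /f' /f.
  case: (e x x'); last by rewrite !mulr0.
  case: (e x y); last by rewrite mul0r !mulr0.
  case: (e x z); last by rewrite mul0r !mulr0.
  by move=> /(_ isT isT isT)/or3P[] ->; rewrite subrr ?mul0r ?mulr0.
set S := \sum_(x in A) _; set a : R := #|A|%:R in dense *.
set b : R := #|B|%:R; set c : R := #|C|%:R.
rewrite -/S in dense.
have [a0 b0 c0] : [/\ 0 < a, 0 < b & 0 < c] by rewrite !ltr0n.
have e5 : 0 <= eta ^+ 5 by rewrite exprn_ge0 //; case/andP: eta_itv.
have k1 : eta ^+ 5 * (a ^+ 2 * (b * c)) <= eta ^+ 5 * (6 * S * (b * c)).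
  by rewrite ler_wpM2l // ler_wpM2r // mulr_ge0 // ltW.
have k2 : 30 * eps * (a ^+ 2 * (b * c)) < eta ^+ 5 * (a ^+ 2 * (b * c)).
  by rewrite ltr_pM2r // !mulr_gt0.
move: k1 k2; rewrite (expr2 a); lra.
Qed.
End Claws.

(** * Reduced templates of claw-free graphs *)

Section RegularPair.
Variables (R : realFieldType) (V L : finType) (f : V -> V -> R) (c : V -> L).

Lemma regular_discrepancy eps i j X Y : ~~ irregular f c eps i j ->
  `|discrepancy f c i j X Y| <= eps * (#|cell c i|%:R * #|cell c j|%:R).
Proof. by move/existsPn => /(_ (X, Y)); rewrite -leNgt. Qed.

Lemma lower_uniform_edge eps eta i j :
  ~~ irregular f c eps i j -> eta <= density f c i j ->
  lower_uniform eps eta f (cell c i) (cell c j).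
Proof.
move=> reg d_ge; apply: (lower_uniform_of_discrepancy d_ge) => X Y.
exact: regular_discrepancy.
Qed.

Lemma lower_uniform_nonedge eps eta i j :
  ~~ irregular f c eps i j -> density f c i j <= 1 - eta ->
  lower_uniform eps eta (fun x y => 1 - f x y) (cell c i) (cell c j).
Proof.
move=> reg d_le.
apply: (@lower_uniform_of_discrepancy _ _ _ _ (1 - density f c i j)).
  by lra.
move=> X Y; rewrite -normrN -sumrN.
rewrite (_ : \sum_(x in _) _ = discrepancy f c i j X Y).
  exact: regular_discrepancy.
apply: eq_bigr => x _; rewrite -sumrN; apply: eq_bigr => y _.
by rewrite -mulNr; congr (_ * _); ring.
Qed.

Lemma density_sym i j : (forall x y, f x y = f y x) ->
  density f c i j = density f c j i.
Proof.
move=> sym_f; rewrite /density mulrC [RHS]mulrC exchange_big /=.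
rewrite [#|cell c i|%:R * _]mulrC; congr (_ * _).
by apply: eq_bigr => x _; apply: eq_bigr => y _.
Qed.
End RegularPair.

(* [Some b] forces the pair to have adjacency [b]; [None] leaves it free. *)
Definition cost (t : option bool) : nat :=
  if t is Some b then (if b then 2 else 1)%N else 0%N.

Definition violates (t : option bool) (b : bool) : bool :=
  if t is Some b' then b != b' else false.

Section Template.
Variables (R : realFieldType) (V L : finType) (e : rel V) (c : V -> L).
Variables (eps eta : R).
Hypothesis sym_e : symmetric e.
Hypothesis no_claw : has_no_claw e.
Hypotheses (eps_ge0 : 0 <= eps) (eta_gt0 : 0 < eta) (eta_lt : eta < 1 / 2).
Hypothesis eps_eta : 60 * eps = eta ^+ 5.

Let eta_itv : 0 <= eta <= 1.
Proof. by rewrite (ltW eta_gt0) (le_trans (ltW eta_lt)) //; lra. Qed.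

Let eta5 : 0 < eta ^+ 5. Proof. by rewrite exprn_gt0. Qed.

Let eps_lt : 30 * eps < eta ^+ 5.
Proof. by move: eps_eta eta5; lra. Qed.

Let eps_le : 24 * eps <= eta ^+ 3.
Proof.
have /andP[e0 e1] := eta_itv.
have : eta ^+ 5 <= eta ^+ 3.
  by rewrite -[5%N]/(3 + 2)%N exprD ler_piMr ?exprn_ge0 // expr_le1.
by move: eps_eta eps_ge0 eta5; lra.
Qed.

Let f x y : R := (e x y)%:R.
Let d := density f c.

Definition template (i j : L) : option bool :=
  if d i j < eta then Some false
  else if 1 - eta < d i j then Some true else None.

Definition small_cell (i : L) : bool := eta ^+ 3 * #|cell c i|%:R <= 8.

(** These are the pairs to which the counting lemmas are not applied. Irregularity is excluded in
    both orders to make the relation symmetric, as [sum_pairs_le] requires of [grey]. *)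
Definition exceptional (x y : V) : bool :=
  [|| irregular f c eps (c x) (c y), irregular f c eps (c y) (c x),
      small_cell (c x), small_cell (c y) | c x == c y].

(** Exceptional pairs count as full and never as grey, so that two grey neighbours of a vertex
    always form a full pair. *)
Let grey x y := (template (c x) (c y) == None) && ~~ exceptional x y.
Let full x y := (template (c x) (c y) == Some true) || exceptional x y.

Lemma template_sym i j : template i j = template j i.
Proof.
by rewrite /template /d density_sym // => x y; rewrite /f sym_e.
Qed.

Lemma exceptional_sym x y : exceptional x y = exceptional y x.
Proof.
rewrite /exceptional eq_sym.
by case: (irregular _ _ _ _ _); case: (irregular _ _ _ _ _);
  case: (small_cell _); case: (small_cell _).
Qed.

Lemma templateNone i j :
  template i j = None -> eta <= d i j /\ d i j <= 1 - eta.
Proof. by rewrite /template; do 2 case: ltP. Qed.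

(* Otherwise there is a claw with its centre and one leaf in the cell of [x]
   and the other two leaves in the cells of [y] and [z]. *)
Lemma grey_grey_full x y z : grey x y -> grey x z -> full y z.
Proof.
move=> /andP[/eqP txy exy] /andP[/eqP txz exz].
rewrite /full; case: (boolP (exceptional y z)) => [|eyz]; first by rewrite orbT.
rewrite orbF; apply/eqP.
move: exy exz eyz; rewrite /exceptional !negb_or.
move=> /and5P[rxy ryx sx sy nxy] /and5P[rxz rzx _ sz nxz] /and5P[ryz _ _ _ nyz].
have [dxy dxy'] := templateNone txy; have [dxz dxz'] := templateNone txz.
have card0 i : (0 < #|cell c (c i)|)%N by apply/card_gt0P; exists i; apply: mem_cell.
have disj i j : c i != c j -> [disjoint cell c (c i) & cell c (c j)].
  move=> nij; apply/pred0P => k /=; rewrite !inE.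
  by apply: contra_neqF nij => /andP[/eqP <- /eqP <-].
have dense := leaf_cell_dense sym_e no_claw eps_ge0 eta_itv _ _ (card0 y)
  (lower_uniform_edge rxy dxy).
have dns := center_cell_sparse no_claw eps_ge0 eta_itv _
  (card0 x) (card0 y) (card0 z) (disj _ _ nxy) (disj _ _ nxz) (disj _ _ nyz)
  (lower_uniform_edge rxy dxy) (lower_uniform_nonedge rxy dxy')
  (lower_uniform_edge rxz dxz) (lower_uniform_nonedge rxz dxz').
rewrite /template; case: ltP => [dlt|dge]; last case: ltP => // dle; exfalso.
  apply: dns => //; last by apply: dense; rewrite // ltNge.
  apply: lower_uniform_nonedge => //; apply: ltW; apply: lt_trans dlt _.
  by move: eta_lt; lra.
apply: dns => //; last by apply: dense; rewrite // ltNge.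
exact: lower_uniform_nonedge.
Qed.

(** Pointwise the cost is at least 1, plus 1 if full, minus 1 if grey, minus 2 if exceptional; by
    [sum_pairs_le] the full pairs outweigh the grey ones. *)
Lemma template_cost :
  #|V|%:R ^+ 2 - 2 * (\sum_x \sum_y (exceptional x y)%:R) <=
  \sum_x \sum_y (cost (template (c x) (c y)))%:R :> R.
Proof.
have grey_sym : symmetric grey.
  by move=> x y; rewrite /grey template_sym exceptional_sym.
have ineq := @sum_pairs_le R V grey full grey_sym grey_grey_full.
have -> : #|V|%:R ^+ 2 = \sum_(x : V) \sum_(y : V) (1 : R).
  by rewrite sum_const2 mul1r expr2.
apply: le_trans (_ : \sum_x \sum_y (1 + ((full x y)%:R - (exceptional x y)%:R)
   - ((grey x y)%:R + (exceptional x y)%:R)) <= _); last first.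
  apply: ler_sum => x _; apply: ler_sum => y _; rewrite /full /grey.
  by case: (template _ _) => [[]|] /=; case: (exceptional x y) => /=; lra.
have -> : \sum_x \sum_y (1 + ((full x y)%:R - (exceptional x y)%:R)
   - ((grey x y)%:R + (exceptional x y)%:R)) =
   \sum_(x : V) \sum_(y : V) (1 : R)
   - 2 * (\sum_x \sum_y (exceptional x y)%:R)
   + ((\sum_x \sum_y (full x y)%:R) - (\sum_x \sum_y (grey x y)%:R)).
  rewrite !mulr_sumr -!sumrB -big_split; apply: eq_bigr => x _.
  rewrite /= mulr_sumr -!sumrB -big_split; apply: eq_bigr => y _ /=.
  by ring.
by lra.
Qed.

(** A low block has edge density below [eta] and a high block nonedge density below [eta];
    [sum_density] reduces the count to these block densities. *)
Lemma template_violations :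
  \sum_x \sum_y (violates (template (c x) (c y)) (e x y))%:R
  <= eta * #|V|%:R ^+ 2.
Proof.
have f01 x y : 0 <= f x y <= 1 by rewrite /f ler0n lern1; case: (e x y).
pose lo i j : R := (template i j == Some false)%:R.
pose hi i j : R := (template i j == Some true)%:R.
have -> : \sum_x \sum_y (violates (template (c x) (c y)) (e x y))%:R =
   \sum_x \sum_y f x y * (lo (c x) (c y) - hi (c x) (c y))
   + \sum_x \sum_y hi (c x) (c y).
  rewrite -big_split; apply: eq_bigr => x _ /=; rewrite -big_split.
  apply: eq_bigr => y _; rewrite /lo /hi /f /=.
  by case: (template _ _) => [[]|]; case: (e x y) => /=; ring.
rewrite (sum_density f c (fun i j => lo i j - hi i j)) -big_split /=.
have -> : eta * #|V|%:R ^+ 2 = \sum_(x : V) \sum_(y : V) eta.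
  by rewrite sum_const2 expr2.
apply: ler_sum => x _; rewrite -big_split /=; apply: ler_sum => y _.
have /andP[d0 d1] := density_itv c f01 (c x) (c y).
rewrite /lo /hi /template -/d; move: d0 d1; rewrite -/d => d0 d1.
move: (d _ _) d0 d1 eta_gt0 eta_lt => t t0 t1 e0 e1.
case: ltP => [lo_t|_] /=; first by move: lo_t; lra.
by case: ltP => [hi_t|_] /=; lra.
Qed.
End Template.

Lemma sum_small_cell (R : realFieldType) (V L : finType) (c : V -> L)
    (eta : R) : 0 < eta ->
  \sum_x (small_cell c eta (c x))%:R <= #|L|%:R * (8 / eta ^+ 3).
Proof.
move=> eta0; rewrite (partition_big c predT) //=.
have -> : #|L|%:R * (8 / eta ^+ 3) = \sum_(i : L) (8 / eta ^+ 3).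
  by rewrite sumr_const mulr_natl.
apply: ler_sum => i _.
have -> : \sum_(x | c x == i) (small_cell c eta (c x))%:R =
    \sum_(x in cell c i) (small_cell c eta i)%:R :> R.
  by apply: eq_big => [x|x /eqP-> //]; rewrite inE.
rewrite sumr_const; case: (boolP (small_cell c eta i)) => [small|_] /=.
  by rewrite ler_pdivlMr ?exprn_gt0 // mulrC.
by rewrite mul0rn divr_ge0 // exprn_ge0 // ltW.
Qed.

(** Within a residue class a number is determined by its quotient by [N.+1]. *)
Lemma card_residue_class (n N a : nat) :
  (\sum_(y < n) (a == y %[mod N.+1]) <= n %/ N.+1 + 1)%N.
Proof.
have -> : (\sum_(y < n) (a == y %[mod N.+1]) =
          #|[set y : 'I_n | a == y %[mod N.+1]]|)%N.
  by rewrite -sum1dep_card [RHS]big_mkcond; apply: eq_bigr => y _; case: eqP.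
rewrite addn1.
pose h (y : 'I_n) : 'I_(n %/ N.+1).+1 := inord (y %/ N.+1)%N.
have hE (y : 'I_n) : h y = (y %/ N.+1)%N :> nat.
  by rewrite inordK // ltnS leq_div2r // ltnW.
rewrite -[leqRHS]card_ord -(card_in_imset (f := h)) ?max_card //.
move=> y z; rewrite !inE => /eqP ay /eqP az /(congr1 val).
rewrite /= !hE => yz; apply: val_inj.
by rewrite /= (divn_eq y N.+1) (divn_eq z N.+1) yz -ay -az.
Qed.

Section SumExceptional.
Variables (R : realFieldType) (n N : nat) (L : finType) (e : rel 'I_n).
Variables (c : 'I_n -> L) (eps eta delta : R).
Hypothesis eta_gt0 : 0 < eta.
Hypothesis c_mod : forall x y, c x = c y -> x = y %[mod N.+1].
Hypothesis irr_le :
  \sum_x \sum_y (irregular (fun x y => (e x y)%:R) c eps (c x) (c y))%:R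
  <= delta * n%:R ^+ 2 :> R.

Lemma sum_exceptional_le :
  \sum_x \sum_y (exceptional e c eps eta x y)%:R <=
  2 * (delta * n%:R ^+ 2) + 2 * (n%:R * (#|L|%:R * (8 / eta ^+ 3)))
  + n%:R * (n%:R / N.+1%:R + 1).
Proof.
pose irr x y : R := (irregular (fun x y => (e x y)%:R) c eps (c x) (c y))%:R.
pose sm x : R := (small_cell c eta (c x))%:R.
pose same (x y : 'I_n) : R := (x == y %[mod N.+1])%:R.
have split_exc x y : (exceptional e c eps eta x y)%:R <=
    (irr x y + irr y x) + (sm x + sm y) + same x y.
  have cs : ((c x == c y) <= (x == y %[mod N.+1]))%N.
    by case: eqP => // /c_mod ->; rewrite eqxx.
  rewrite /exceptional /irr /sm /same -!natrD ler_nat.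
  move: cs; case: (irregular _ _ _ _ _); case: (irregular _ _ _ _ _);
  case: (small_cell _ _ _); case: (small_cell _ _ _); case: (c x == c y);
  by case: (x == y %[mod _]).
apply: le_trans (ler_sum _ (fun x _ => ler_sum _ (fun y _ => split_exc x y))) _.
under eq_bigr do rewrite !big_split /=.
rewrite !big_split /= [X in _ + X + _ + _]exchange_big /=.
have sm_le : \sum_x \sum_(y : 'I_n) sm x <= n%:R * (#|L|%:R * (8 / eta ^+ 3)).
  rewrite exchange_big sumr_const card_ord -[leLHS]mulr_natl ler_wpM2l //.
  exact: sum_small_cell.
have sm_le' : \sum_(x : 'I_n) \sum_y sm y <= n%:R * (#|L|%:R * (8 / eta ^+ 3)).
  by rewrite exchange_big.
have same_le : \sum_x \sum_y same x y <= n%:R * (n%:R / N.+1%:R + 1).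
  have -> : n%:R * (n%:R / N.+1%:R + 1) = \sum_(x < n) (n%:R / N.+1%:R + 1) :> R.
    by rewrite sumr_const card_ord -[RHS]mulr_natl.
  apply: ler_sum => x _.
  apply: (@le_trans _ _ ((n %/ N.+1) + 1)%:R).
    by rewrite -natr_sum ler_nat card_residue_class.
  rewrite natrD lerD2r ler_pdivlMr ?ltr0n // -natrM ler_nat.
  exact: leq_divM.
have irr_le' : \sum_x \sum_y irr x y <= delta * n%:R ^+ 2 by [].
have twice (a : R) : 2 * a = a + a by ring.
rewrite !twice.
by rewrite !lerD.
Qed.
End SumExceptional.

(** The label type varies with the graph, and the union bound needs one fixed finite type. The
    recoding is injective on the labels in use, so [t'] is well defined there; it is [None] at pairs
    of codes that do not occur. *)
Lemma encode_labels (n K : nat) (L : finType) (c : 'I_n -> L)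
    (t : L -> L -> option bool) : (#|L| <= K)%N ->
  exists c' : {ffun 'I_n -> 'I_K.+1},
  exists t' : {ffun 'I_K.+1 * 'I_K.+1 -> option bool},
  forall x y, t' (c' x, c' y) = t (c x) (c y).
Proof.
move=> LK; pose c' := [ffun x : 'I_n => inord (enum_rank (c x)) : 'I_K.+1].
have c'_inj x y : c' x = c' y -> c x = c y.
  rewrite !ffunE => /(congr1 val) /=.
  rewrite !inordK; last 2 first.
  - by apply: leq_trans (ltn_ord _) (leqW LK).
  - by apply: leq_trans (ltn_ord _) (leqW LK).
  by move=> /val_inj /enum_rank_inj.
exists c', [ffun ab => if [pick xy | (c' xy.1, c' xy.2) == ab] is Some xy
                       then t (c xy.1) (c xy.2) else None].
move=> x y; rewrite ffunE; case: pickP => [[x' y'] /= /eqP[h h']|/(_ (x, y))].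
  by rewrite (c'_inj _ _ h) (c'_inj _ _ h').
by rewrite eqxx.
Qed.

(** [K] does not depend on [n], so all claw-free graphs on [n] vertices are covered by [2^O(n)]
    choices of [c] and [t]. *)
Theorem claw_free_template (R : realType) (eta delta : R) :
  0 < eta -> eta < 1 / 2 -> 0 < delta -> exists K n0 : nat,
  forall (n : nat) (e : rel 'I_n), (n0 <= n)%N ->
  symmetric e -> has_no_claw e ->
  exists c : {ffun 'I_n -> 'I_K.+1},
  exists t : {ffun 'I_K.+1 * 'I_K.+1 -> option bool},
  [/\ forall x y, t (c x, c y) = t (c y, c x),
      (1 - delta) * n%:R ^+ 2 <= \sum_x \sum_y (cost (t (c x, c y)))%:R &
      \sum_x \sum_y (violates (t (c x, c y)) (e x y))%:R <= eta * n%:R ^+ 2].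
Proof.
move=> eta0 eta_lt delta0.
have [N N_gt] := exists_nat_gt (12 / delta).
(* Small enough for both [24 eps <= eta^3] and [30 eps < eta^5]. *)
pose eps := eta ^+ 5 / 60.
have eps0 : 0 < eps by rewrite divr_gt0 ?exprn_gt0.
have delta'0 : 0 < delta / 12 by rewrite divr_gt0.
have [M reg] := regularity_lemma N eps0 delta'0.
pose K := \max_(m < M) #|labels N.+1 m|.
(* The first term absorbs the [+ 1] in the size of a residue class. The second, with [192 = 8 * 24],
   bounds the pairs at small cells by [delta / 24] in each order. In all at most [5 delta / 12] of
   the pairs are exceptional, and [template_cost] doubles this. *)
have [n0 n0_gt] := exists_nat_gt (12 / delta + 192 * K%:R / (eta ^+ 3 * delta)).
exists K, n0 => n e n_ge sym_e no_claw.
have f01 (x y : 'I_n) : 0 <= ((e x y)%:R : R) <= 1.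
  by rewrite ler0n lern1; case: (e x y).
have [m [c [mM c_mod irr_le]]] := reg n (fun x y => (e x y)%:R) f01.
have LK : (#|labels N.+1 m| <= K)%N.
  exact: (@leq_bigmax _ (fun m : 'I_M => #|labels N.+1 m|) (Ordinal mM)).
have [c' [t' tE]] := encode_labels c (template e c eta) LK.
exists c', t'; split.
- by move=> x y; rewrite !tE template_sym.
- have eps_eta : 60 * eps = eta ^+ 5 by rewrite /eps; field.
  under eq_bigr do under eq_bigr do rewrite tE.
  apply: le_trans (template_cost c sym_e no_claw (ltW eps0) eta0 eta_lt eps_eta).
  rewrite card_ord mulrBl mul1r lerD2l lerN2.
  have := sum_exceptional_le eta0 c_mod irr_le.
  set S := \sum_x _ => S_le.
  have nn : (n0%:R <= n%:R :> R) by rewrite ler_nat.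
  have e3 : 0 < eta ^+ 3 by rewrite exprn_gt0.
  have q0 : 0 <= 192 * K%:R / (eta ^+ 3 * delta).
    by rewrite divr_ge0 ?mulr_ge0 ?ler0n // ltW // mulr_gt0.
  have q1 : 0 < 12 / delta by rewrite divr_gt0.
  have n12 : 12 <= delta * n%:R.
    rewrite mulrC -ler_pdivrMr //; apply: le_trans _ nn; apply: ltW.
    by apply: le_lt_trans _ n0_gt; rewrite lerDl.
  have nK : 192 * K%:R <= eta ^+ 3 * (delta * n%:R).
    rewrite mulrA [leRHS]mulrC -ler_pdivrMr ?mulr_gt0 //; apply: le_trans _ nn.
    by apply: ltW; apply: le_lt_trans _ n0_gt; rewrite lerDr ltW.
  have nn0 : 0 <= (n%:R : R) by rewrite ler0n.
  have b1 : n%:R * (#|labels N.+1 m|%:R * (8 / eta ^+ 3)) <=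
            delta / 24 * n%:R ^+ 2.
    have -> : delta / 24 * n%:R ^+ 2 = n%:R * (delta * n%:R / 24) by ring.
    rewrite ler_wpM2l // mulrA ler_pdivrMr //.
    have : (#|labels N.+1 m|%:R <= K%:R :> R) by rewrite ler_nat.
    lra.
  have b2 : n%:R / N.+1%:R <= delta / 12 * n%:R.
    rewrite mulrC ler_wpM2r // -[leLHS]mul1r ler_pdivrMr ?ltr0n //.
    have : 12 / delta < N.+1%:R by apply: lt_trans N_gt _; rewrite ltr_nat.
    by rewrite ltr_pdivrMr // => /ltW; lra.
  have b3 : n%:R * (n%:R / N.+1%:R + 1) <= delta / 6 * n%:R ^+ 2.
    have -> : delta / 6 * n%:R ^+ 2 =
      n%:R * (delta / 12 * n%:R + delta * n%:R / 12) by field.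
    by rewrite ler_wpM2l // lerD //; lra.
  have n2 : 0 <= delta * n%:R ^+ 2 by rewrite mulr_ge0 ?exprn_ge0 // ltW.
  move: S_le b1 b3 n2; set A := n%:R * (_ * _); set B := n%:R * (_ + _).
  by move: A B (n%:R ^+ 2) => A B P; clear; lra.
- under eq_bigr do under eq_bigr do rewrite tE.
  have := template_violations e c eta0 eta_lt.
  by rewrite card_ord.
Qed.

(** * Sums over labelled graphs *)

Lemma claw_free_has_no_claw (V : finType) (G : sgraph V) :
  claw_free G -> has_no_claw (adj G).
Proof.
move=> cf x y1 y2 y3 uniq_y xy1 xy2 xy3.
apply: contraT => /norP[n12 /norP[n13 n23]].
case: cf; pose ys := [:: y1; y2; y3].
pose leaf (k : 'I_3) : V := nth x ys k.
pose S : {set V} := [set z in x :: ys].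
have in_S z : z \in x :: ys -> z \in S by rewrite in_set.
have leafS k : leaf k \in S by rewrite in_S // inE mem_nth ?orbT.
have xS : x \in S by rewrite in_S // mem_head.
pose g (u : 'I_1 + 'I_3) : {z | z \in S} :=
  match u with inl _ => Sub x xS | inr k => Sub (leaf k) (leafS k) end.
have adj_leaf k : adj G x (leaf k).
  by case: k => -[|[|[|//]]].
have nadj_leaf k l : adj G (leaf k) (leaf l) = false.
  apply/negbTE; case: k => -[|[|[|//]]] ? ; case: l => -[|[|[|//]]] ?;
  rewrite /leaf /= ?adj_irr // 1?adj_sym //.
have g_inj : injective g.
  move=> [i|k] [j|l] /(congr1 val) /=.
  - by rewrite (ord1 i) (ord1 j).
  - by move=> xl; have := adj_leaf l; rewrite -xl adj_irr.
  - by move=> xk; have := adj_leaf k; rewrite xk adj_irr.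
  - move/eqP; rewrite nth_uniq ?ltn_ord // => /eqP kl.
    by congr inr; apply: val_inj.
have g_surj z : exists u, g u = z.
  case: z => z zS; suff [u uz] : exists u, val (g u) = z.
    by exists u; apply: val_inj.
  move: zS; rewrite in_set in_cons => /orP[/eqP-> |/(nthP x)[k k3 <-]].
    by exists (inl ord0).
  by exists (inr (Ordinal k3)).
have [h gh hg] : bijective g.
  apply: inj_card_bij => //.
  rewrite -(card_codom g_inj); apply: subset_leq_card.
  by apply/subsetP => z _; have [u <-] := g_surj z; apply: codom_f.
exists S; exists h; first by exists g.
move=> z w; rewrite -{2}(hg z) -{2}(hg w).
rewrite {1}/adj ffunE /= /adj ffunE /=.
case: (h z) => [i|k]; case: (h w) => [j|l] /=.
- by rewrite adj_irr.
- by rewrite adj_leaf.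
- by rewrite adj_sym adj_leaf.
- by rewrite nadj_leaf.
Qed.

Lemma has_no_claw_claw_free (V : finType) (G : sgraph V) :
  has_no_claw (adj G) -> claw_free G.
Proof.
move=> no_claw [S [f [g fg gf] f_adj]].
have adjE u w : adj G (val (g u)) (val (g w)) =
    adj (complete_bipartite 1 3) u w.
  by rewrite -[in RHS](gf u) -[in RHS](gf w) f_adj /adj ffunE.
pose y k : V := val (g (inr k)).
have y_inj : injective y by move=> k l /val_inj /(can_inj gf) [].
pose o k (k3 : (k < 3)%N) : 'I_3 := Ordinal k3.
have := no_claw (val (g (inl ord0))) (y (o 0 isT)) (y (o 1 isT)) (y (o 2 isT)).
rewrite !adjE {1}/adj !ffunE /= !inE !(inj_eq y_inj) /=.
by rewrite /adj !ffunE /= => /(_ isT isT isT isT).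
Qed.

Section SumGraphs.
Variables (R : realType) (n : nat).

(** A graph is encoded by its pairs [i < j]; [false] elsewhere matches the default value given to
    [big_distr_big_dep]. *)
Let code (G : sgraph 'I_n) : {ffun 'I_n * 'I_n -> bool} :=
  [ffun p : 'I_n * 'I_n => (p.1 < p.2)%N && adj G p.1 p.2].

Let drel (f : {ffun 'I_n * 'I_n -> bool}) : rel 'I_n := fun x y =>
  ((x < y)%N && f (x, y)) || ((y < x)%N && f (y, x)).

Let drel_irr f : irreflexive (drel f).
Proof. by move=> x; rewrite /drel ltnn. Qed.

Let drel_sym f : symmetric (drel f).
Proof. by move=> x y; rewrite /drel orbC. Qed.

Let decode f : sgraph 'I_n := sgraph_of_rel (@drel_irr f) (@drel_sym f).

Let adj_decode f (i j : 'I_n) : (i < j)%N -> adj (decode f) i j = f (i, j).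
Proof.
by move=> ij; rewrite /adj ffunE /= /drel ij ltnNge (ltnW ij) orbF.
Qed.

Let codeK G : decode (code G) = G.
Proof.
apply: val_inj; apply/ffunP => -[x y]; rewrite !ffunE /= /drel !ffunE /=.
rewrite [adj G y x]adj_sym !andbA !andbb -andb_orl.
case: (ltngtP x y) => //= /val_inj->; exact/esym/adj_irr.
Qed.

(** Independence of the pairs: a graph is a free choice of a boolean for each [i < j], so the sum
    distributes over the product. *)
Lemma sum_graph_prod (F : 'I_n -> 'I_n -> bool -> R) :
  \sum_(G : sgraph 'I_n) \prod_(i < n) \prod_(j < n | (i < j)%N) F i j (adj G i j)
  = \prod_(i < n) \prod_(j < n | (i < j)%N) (F i j true + F i j false).
Proof.
pose P (p : 'I_n * 'I_n) := (p.1 < p.2)%N.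
have -> : \prod_(i < n) \prod_(j < n | (i < j)%N) (F i j true + F i j false) =
    \prod_(p | P p) \sum_(b : bool) F p.1 p.2 b.
  rewrite pair_big_dep; apply: eq_bigr => -[i j] _ /=.
  by rewrite big_bool.
rewrite (big_distr_big_dep false) /=.
rewrite (reindex_onto decode code (fun G _ => codeK G)) /=.
apply: eq_big => [f|f _].
  apply/eqP/familyP => [<- p|fP].
    by rewrite ffunE /in_mem /= /P; case: (p.1 < p.2)%N.
  apply/ffunP => -[x y]; rewrite ffunE /=; have := fP (x, y); rewrite /in_mem /= /P /=.
  by case: ltnP => [xy _|_] /=; [rewrite adj_decode | move/eqP].
rewrite pair_big_dep; apply: eq_bigr => -[i j] /= ij.
by rewrite adj_decode.
Qed.
End SumGraphs.

(** * Probability bounds *)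

Lemma sum_sym_pairs (R : realFieldType) (n : nat) (g : 'I_n -> 'I_n -> R) :
  (forall x y, g x y = g y x) ->
  \sum_x \sum_y g x y =
  2 * (\sum_(i < n) \sum_(j < n | (i < j)%N) g i j) + \sum_x g x x.
Proof.
move=> g_sym.
have row (x : 'I_n) : \sum_y g x y =
   \sum_(y < n | (x < y)%N) g x y + \sum_(y < n | (y < x)%N) g x y + g x x.
  rewrite (bigID (fun y : 'I_n => (x < y)%N)) /= -addrA; congr (_ + _).
  rewrite (bigD1 x) ?ltnn //= addrC; congr (_ + _); apply: eq_bigl => y.
  by rewrite -leqNgt -(inj_eq val_inj) ltn_neqAle andbC.
rewrite (eq_bigr _ (fun x _ => row x)) !big_split /=; congr (_ + _).
have -> : \sum_(x < n) \sum_(y < n | (y < x)%N) g x y =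
          \sum_(x < n) \sum_(y < n | (x < y)%N) g x y.
  rewrite (exchange_big_dep predT) //=; apply: eq_bigr => x _.
  by apply: eq_bigr => y _.
by ring.
Qed.

Lemma natr_bin2 (R : realFieldType) (n : nat) :
  'C(n, 2)%:R = n%:R * (n%:R - 1) / 2 :> R.
Proof.
case: n => [|n]; first by rewrite bin0n mul0r mul0r.
have := mul_bin_diag n.+1 1; rewrite bin1 => /(congr1 (fun k => k%:R : R)).
rewrite !natrM => h; rewrite -(natr1 n) addrK natr1 h.
by field.
Qed.

Lemma sum_pairs1 (R : realFieldType) (n : nat) :
  \sum_(i < n) \sum_(j < n | (i < j)%N) 1 = 'C(n, 2)%:R :> R.
Proof.
have := @sum_sym_pairs R n (fun _ _ => 1) (fun _ _ => erefl).
rewrite !sumr_const card_ord -mulrnA natrM natr_bin2.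
by move: (\sum_(i < n) _) (n%:R) => S m; lra.
Qed.

(** * Upper bound by an exponential moment and a union over templates *)

Section UpperBound.
Variables (R : realType) (p rho : R).
Hypotheses (hp0 : 0 < p) (hp1 : p < 1) (rho_gt0 : 0 < rho).
Hypotheses (h0 : 1 - p <= expR (- rho)) (h1 : p <= expR (- (2 * rho))).

Let penalty (theta : R) (t : option bool) (b : bool) : R :=
  if violates t b then theta else 1.

(** This [theta] is small relative to both [p] and [1 - p]: the sum is [p (1 + tau (1 - p)^2)] for a
    forced edge and [(1 - p) (1 + tau p^2)] for a forced nonedge, and [1 + x <= expR x] finishes. *)
Lemma penalized_mass_le (tau theta : R) (t : option bool) :
  0 < tau -> tau <= 1 -> theta = tau * p * (1 - p) ->
  bernoulli_pmf p true * penalty theta t true +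
  bernoulli_pmf p false * penalty theta t false <=
  expR (- ((rho - tau) * (cost t)%:R)).
Proof.
move=> t0 t1 ->; rewrite /bernoulli_pmf /penalty.
have q0 : 0 < 1 - p by rewrite subr_gt0.
case: t => [[]|] /=; last by rewrite mulr0 oppr0 expR0 !mulr1 addrC subrK.
- have -> : - ((rho - tau) * 2) = - (2 * rho) + 2 * tau by ring.
  rewrite expRD; apply: le_trans (_ : p * (1 + 2 * tau) <= _).
    have : 0 <= p * tau * (1 - (1 - p) ^+ 2 + 1).
      rewrite mulr_ge0 ?mulr_ge0 ?(ltW hp0) ?(ltW t0) //.
      have : (1 - p) ^+ 2 <= 1 by rewrite expr_le1 ?(ltW q0) //; move: hp0; lra.
      by lra.
    by lra.
  by apply: ler_pM; rewrite ?expR_ge1Dx //; [exact: ltW | lra].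
have -> : - ((rho - tau) * 1) = - rho + tau by ring.
rewrite expRD; apply: le_trans (_ : (1 - p) * (1 + tau) <= _).
  have : 0 <= (1 - p) * tau * (1 - p ^+ 2).
    rewrite mulr_ge0 ?mulr_ge0 ?(ltW q0) ?(ltW t0) //.
    have : p ^+ 2 <= 1 by rewrite expr_le1 // ltW.
    by lra.
  by lra.
by apply: ler_pM; rewrite ?expR_ge1Dx //; [exact: ltW | lra].
Qed.

Section FixedTemplate.
Variables (n K : nat) (c : {ffun 'I_n -> 'I_K.+1}).
Variable t : {ffun 'I_K.+1 * 'I_K.+1 -> option bool}.
Variables (tau theta : R).
Hypotheses (tau_gt0 : 0 < tau) (tau_le1 : tau <= 1).
Hypothesis thetaE : theta = tau * p * (1 - p).

Let theta_gt0 : 0 < theta.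
Proof. by rewrite thetaE !mulr_gt0 // subr_gt0. Qed.

Definition penalized_gnp (G : sgraph 'I_n) : R :=
  \prod_(i < n) \prod_(j < n | (i < j)%N)
    (bernoulli_pmf p (adj G i j) * penalty theta (t (c i, c j)) (adj G i j)).

Lemma penalized_gnp_ge0 G : 0 <= penalized_gnp G.
Proof.
rewrite /penalized_gnp; apply: prodr_ge0 => i _; apply: prodr_ge0 => j _.
rewrite mulr_ge0 ?bernoulli_pmf_ge0 ?(ltW hp0) ?(ltW hp1) //.
by rewrite /penalty; case: ifP => _; rewrite ?ltW.
Qed.

Lemma sum_penalized_gnp :
  \sum_(G : sgraph 'I_n) penalized_gnp G <=
  expR (- ((rho - tau) *
     (\sum_(i < n) \sum_(j < n | (i < j)%N) (cost (t (c i, c j)))%:R))).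
Proof.
rewrite (sum_graph_prod (fun i j b =>
  bernoulli_pmf p b * penalty theta (t (c i, c j)) b)).
rewrite mulr_sumr -sumrN expR_sum; apply: ler_prod => i _.
rewrite mulr_sumr -sumrN expR_sum; apply/andP; split.
  apply: prodr_ge0 => j _; rewrite addr_ge0 // mulr_ge0 ?bernoulli_pmf_ge0
    ?(ltW hp0) ?(ltW hp1) // /penalty; case: ifP => _; rewrite ?ltW //.
apply: ler_prod => j _; apply/andP; split.
  rewrite addr_ge0 // mulr_ge0 ?bernoulli_pmf_ge0
    ?(ltW hp0) ?(ltW hp1) // /penalty; case: ifP => _; rewrite ?ltW //.
exact: penalized_mass_le.
Qed.

(** Each violation costs a factor [expR (- l)], and the violations at [i < j] are among the at most
    [X] ordered ones. *)
Lemma gnp_le_penalized (G : sgraph 'I_n) (l X : R) :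
  theta = expR (- l) -> 0 <= l ->
  \sum_x \sum_y (violates (t (c x, c y)) (adj G x y))%:R <= X ->
  gnp p G <= expR (l * X) * penalized_gnp G.
Proof.
move=> theta_l l0 viol.
have -> : penalized_gnp G = gnp p G * expR (- l * \sum_(i < n)
    \sum_(j < n | (i < j)%N) (violates (t (c i, c j)) (adj G i j))%:R).
  rewrite /penalized_gnp /gnp mulr_sumr expR_sum -big_split.
  apply: eq_bigr => i _; rewrite mulr_sumr expR_sum -big_split.
  apply: eq_bigr => j _ /=; congr (_ * _); rewrite /penalty.
  by case: (violates _ _); rewrite ?mulr1 ?mulr0 ?expR0.
rewrite mulrCA -expRD -[leLHS]mulr1 ler_wpM2l //.
  apply: prodr_ge0 => i _; apply: prodr_ge0 => j _.
  by rewrite bernoulli_pmf_ge0 ?(ltW hp0) ?(ltW hp1).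
rewrite -[leLHS]expR0 ler_expR mulNr -mulrBr mulr_ge0 // subr_ge0.
apply: le_trans viol; apply: ler_sum => i _.
rewrite [leLHS]big_mkcond; apply: ler_sum => j _.
by case: ifP => _; rewrite ?lexx ?ler0n.
Qed.
End FixedTemplate.

(** The diagonal costs at most [2 n], hence the loss of [n] after halving. *)
Lemma pair_cost_ge (n : nat) (s : 'I_n -> 'I_n -> option bool) (delta : R) :
  (forall x y, s x y = s y x) ->
  (1 - delta) * n%:R ^+ 2 <= \sum_x \sum_y (cost (s x y))%:R ->
  ((1 - delta) * n%:R ^+ 2) / 2 - n%:R
  <= \sum_(i < n) \sum_(j < n | (i < j)%N) (cost (s i j))%:R.
Proof.
move=> s_sym; rewrite (sum_sym_pairs (g := fun x y => (cost (s x y))%:R)); last first.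
  by move=> x y; rewrite s_sym.
have : \sum_x (cost (s x x))%:R <= \sum_(x < n) (2 : R).
  by apply: ler_sum => x _; rewrite ler_nat; case: (s x x) => [[]|].
rewrite sumr_const card_ord -mulr_natr.
set A := \sum_x _; set B := \sum_(i < n) _; move: A B => A B.
set P := _ * _ ^+ 2; move: P => P; lra.
Qed.

Lemma pair_cost_le (n : nat) (s : 'I_n -> 'I_n -> option bool) :
  \sum_(i < n) \sum_(j < n | (i < j)%N) (cost (s i j))%:R <= n%:R ^+ 2 :> R.
Proof.
apply: (@le_trans _ _ (\sum_(i < n) \sum_(j < n | (i < j)%N) 2)).
  apply: ler_sum => i _; apply: ler_sum => j _; rewrite ler_nat.
  by case: (s i j) => [[]|].
have -> : \sum_(i < n) \sum_(j < n | (i < j)%N) 2 = 2 * 'C(n, 2)%:R :> R.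
  rewrite -sum_pairs1 mulr_sumr; apply: eq_bigr => i _; rewrite mulr_sumr.
  by apply: eq_bigr => j _; rewrite mulr1.
rewrite natr_bin2 expr2; have : 0 <= (n%:R : R) by rewrite ler0n.
by move: (n%:R) => m; lra.
Qed.

Theorem gnp_prob_claw_free_le (eps : R) : 0 < eps -> exists n0 : nat,
  forall n : nat, (n0 <= n)%N ->
  gnp_prob p (claw_free_graphs n) <= expR (- ((rho - eps) * 'C(n, 2)%:R)).
Proof.
(* Four errors of [tau n^2] arise: from the violations, from [tau] times the cost, from [delta], and
   from the number of templates with the linear terms. As ['C(n, 2) >= n^2 / 4] for [n >= 2],
   together they are at most [16 tau 'C(n, 2)]. *)
move=> eps0; pose tau := Num.min (eps / 16) 1.
have tau_gt0 : 0 < tau by rewrite lt_min ltr01 andbT divr_gt0.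
have tau_le1 : tau <= 1 by rewrite ge_min lexx orbT.
have tau_eps : 16 * tau <= eps.
  by rewrite mulrC -ler_pdivlMr // ge_min lexx.
pose theta := tau * p * (1 - p).
have q0 : 0 < 1 - p by rewrite subr_gt0.
have theta_gt0 : 0 < theta by rewrite !mulr_gt0.
have theta_lt1 : theta < 1.
  have : tau * p <= 1 by rewrite mulr_ile1 // ltW.
  rewrite /theta => tp; apply: le_lt_trans (_ : 1 - p < 1); last by move: hp0; lra.
  by rewrite ler_piMl // ltW.
pose l := - ln theta.
have l0 : 0 < l by rewrite oppr_gt0 ln_lt0 // theta_gt0.
have thetaE : theta = expR (- l) by rewrite opprK lnK.
pose eta := Num.min (tau / l) (1 / 3).
have eta_gt0 : 0 < eta by rewrite lt_min !divr_gt0.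
have eta_lt : eta < 1 / 2.
  by apply: le_lt_trans (_ : 1 / 3 < _); [rewrite ge_min lexx orbT | lra].
have eta_tau : l * eta <= tau.
  by rewrite mulrC -ler_pdivlMr // ge_min lexx.
(* Makes the loss [rho * delta * n^2 / 2] equal to [tau n^2]. *)
pose delta := 2 * tau / rho.
have delta_gt0 : 0 < delta by rewrite divr_gt0 // mulr_gt0.
have [K [n1 templ]] := claw_free_template eta_gt0 eta_lt delta_gt0.
pose a := ln (K.+1%:R : R); pose b := (K.+1 * K.+1)%:R * ln (3 : R).
have a0 : 0 <= a by rewrite ln_ge0 // ler1n.
have b0 : 0 <= b by rewrite mulr_ge0 // ln_ge0 //; lra.
have [n2 n2_gt] := exists_nat_gt ((a + b + rho) / tau).
exists (maxn 2 (maxn n1 n2)) => n; rewrite !geq_max => /and3P[n_ge2 n_ge1 n_gen2].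
pose T : finType := ({ffun 'I_n -> 'I_K.+1} *
  {ffun 'I_K.+1 * 'I_K.+1 -> option bool})%type.
pose s (ct : T) (x y : 'I_n) := ct.2 (ct.1 x, ct.1 y).
pose good (ct : T) := [forall x, forall y, s ct x y == s ct y x] &&
  ((1 - delta) * n%:R ^+ 2 <= \sum_x \sum_y (cost (s ct x y))%:R).
pose N : R := n%:R ^+ 2.
pose D : R := - (rho * ((1 - delta) * N / 2 - n%:R)) + tau * N.
have pen0 ct G : 0 <= expR (l * (eta * N)) * penalized_gnp ct.1 ct.2 theta G.
  by rewrite mulr_ge0 ?expR_ge0 // (penalized_gnp_ge0 _ _ tau_gt0).
(* Each claw-free graph is dominated by the term of its own template; the sums are then exchanged
   and the inner one extended to all graphs. *)
have step1 : gnp_prob p (claw_free_graphs n) <=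
    \sum_(ct | good ct) expR (l * (eta * N)) * expR D.
  rewrite /gnp_prob; apply: le_trans
    (_ : \sum_(G in claw_free_graphs n) \sum_(ct | good ct)
       expR (l * (eta * N)) * penalized_gnp ct.1 ct.2 theta G <= _).
    apply: ler_sum => G; rewrite in_set => /asboolP cf.
    have [c [t [t_sym t_cost t_viol]]] :=
      templ n (adj G) n_ge1 (@adj_sym _ G) (claw_free_has_no_claw cf).
    have good_ct : good (c, t).
      rewrite /good t_cost andbT; apply/forallP => x; apply/forallP => y.
      by rewrite /s /= t_sym.
    rewrite (bigD1 (c, t)) //=; apply: le_trans
      (_ : expR (l * (eta * N)) * penalized_gnp c t theta G <= _).
      exact: (gnp_le_penalized _ (ltW l0) t_viol).
    by rewrite lerDl; apply: sumr_ge0 => ct _.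
  rewrite exchange_big /=; apply: ler_sum => ct /andP[/forallP ct_sym ct_cost].
  rewrite -mulr_sumr ler_wpM2l ?expR_ge0 //.
  apply: le_trans (_ : \sum_G penalized_gnp ct.1 ct.2 theta G <= _).
    rewrite [leRHS](bigID (fun G => G \in claw_free_graphs n)) /= lerDl.
    by apply: sumr_ge0 => G _; apply: (penalized_gnp_ge0 _ _ tau_gt0).
  apply: le_trans (sum_penalized_gnp ct.1 ct.2 tau_gt0 tau_le1 erefl) _.
  rewrite ler_expR /D.
  have s_sym x y : s ct x y = s ct y x by apply/eqP/(forallP (ct_sym x)).
  have lo := pair_cost_ge s_sym ct_cost.
  have hi := pair_cost_le (s ct).
  rewrite -/(s ct _ _) /N.
  rewrite mulrBl opprB addrC lerD //.
    by rewrite lerN2 ler_wpM2l // ltW.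
  by rewrite ler_wpM2l // ltW.
apply: le_trans step1 _; rewrite -expRD.
have cardT : #|T|%:R = expR (n%:R * a + b) :> R.
  rewrite card_prod !card_ffun card_option card_bool !card_prod !card_ord.
  by rewrite natrM !natrX expRD /a /b !expRM_natl !lnK // posrE ltr0n.
apply: (@le_trans _ _ (#|T|%:R * expR (l * (eta * N) + D))).
  rewrite mulr_natl -sumr_const [leRHS](bigID good) /= lerDl.
  by apply: sumr_ge0 => ct _; apply: expR_ge0.
rewrite cardT -expRD ler_expR natr_bin2 /D.
have n2R : 2 <= (n%:R : R) by rewrite ler_nat.
have N0 : 0 <= N by rewrite exprn_ge0.
have e1 : l * (eta * N) <= tau * N by rewrite mulrA ler_wpM2r.
have e2 : n%:R * a + b + rho * n%:R <= tau * N.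
  have : (a + b + rho) <= tau * n%:R.
    rewrite mulrC -ler_pdivrMr //; apply/ltW/(lt_le_trans n2_gt).
    by rewrite ler_nat.
  move=> /(ler_wpM2l (ler0n R n)); rewrite /N.
  have : b <= b * n%:R by rewrite ler_peMr //; lra.
  by rewrite expr2; lra.
have e3 : rho * (delta * N) = 2 * tau * N.
  by rewrite /delta; field; apply: lt0r_neq0.
have e4 : N / 4 <= n%:R * (n%:R - 1) / 2.
  by rewrite /N expr2; nra.
have e5 : n%:R * (n%:R - 1) / 2 <= N / 2.
  by rewrite /N expr2; lra.
have e6 : rho * (n%:R * (n%:R - 1) / 2) <= rho * (N / 2).
  by rewrite ler_wpM2l // ltW.
have e7 : 16 * tau * (N / 4) <= eps * (n%:R * (n%:R - 1) / 2).
  by rewrite ler_pM // ?mulr_ge0 ?divr_ge0 // ltW.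
move: e1 e2 e3 e6 e7.
set C := n%:R * (n%:R - 1) / 2; set E := l * (eta * N).
move: E C (delta) => E C u; lra.
Qed.
End UpperBound.

(** * Lower bounds from the empty graph and from two cliques *)

Section LowerBound.
Variables (R : realType) (p : R).
Hypotheses (hp0 : 0 < p) (hp1 : p < 1).

Let q0 : 0 < 1 - p. Proof. by rewrite subr_gt0. Qed.

Let bern_ge0 b : 0 <= bernoulli_pmf p b.
Proof. by rewrite bernoulli_pmf_ge0 // ltW //= ltW. Qed.

Definition template_mass (t : option bool) : R :=
  if t is Some b then bernoulli_pmf p b else 1.

(** The product is the probability of obeying [s]: the weight [F] kills every graph with a
    violation, and the graphs left are claw-free. *)
Lemma gnp_prob_ge_template (n : nat) (s : 'I_n -> 'I_n -> option bool) :
  (forall x y, s x y = s y x) ->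
  (forall G : sgraph 'I_n,
     (forall x y, x != y -> ~~ violates (s x y) (adj G x y)) ->
     has_no_claw (adj G)) ->
  \prod_(i < n) \prod_(j < n | (i < j)%N) template_mass (s i j)
  <= gnp_prob p (claw_free_graphs n).
Proof.
move=> s_sym s_cf.
pose F (i j : 'I_n) b := bernoulli_pmf p b * (~~ violates (s i j) b)%:R.
have F0 i j b : 0 <= F i j b by rewrite mulr_ge0.
have massE i j : template_mass (s i j) = F i j true + F i j false.
  rewrite /F /template_mass; case: (s i j) => [[]|] /=;
    rewrite /bernoulli_pmf ?mulr0 ?mulr1 ?addr0 ?add0r //.
  by rewrite addrC subrK.
under eq_bigr do under eq_bigr do rewrite massE.
rewrite -(sum_graph_prod F) /gnp_prob.
rewrite (bigID (fun G => G \in claw_free_graphs n)) /=.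
rewrite [X in _ + X]big1 ?addr0 => [|G nG].
  apply: ler_sum => G _; apply: ler_prod => i _.
  rewrite prodr_ge0 //=; apply: ler_prod => j _.
  rewrite F0 /= /F -[leRHS]mulr1 ler_wpM2l //.
  by case: (violates _ _).
apply/eqP; apply: contraNT nG => prod_neq0.
rewrite in_set; apply/asboolP; apply: has_no_claw_claw_free.
have ok (i j : 'I_n) : (i < j)%N -> ~~ violates (s i j) (adj G i j).
  move=> ij; apply: contraNT prod_neq0 => /negPn viol.
  rewrite (bigD1 i) //= (bigD1 j) //= /F viol mulr0 !mul0r //.
apply: s_cf => x y; rewrite -(inj_eq val_inj).
case: (ltngtP x y) => // xy _; first exact: ok.
by rewrite s_sym adj_sym ok.
Qed.

Lemma prod_pairs_expR (n : nat) (g : 'I_n -> 'I_n -> R) :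
  \prod_(i < n) \prod_(j < n | (i < j)%N) expR (g i j) =
  expR (\sum_(i < n) \sum_(j < n | (i < j)%N) g i j).
Proof. by rewrite expR_sum; apply: eq_bigr => i _; rewrite expR_sum. Qed.

Lemma gnp_prob_ge_empty (n : nat) :
  expR (ln (1 - p) * 'C(n, 2)%:R) <= gnp_prob p (claw_free_graphs n).
Proof.
apply: le_trans (gnp_prob_ge_template (s := fun _ _ => Some false) _ _) => //.
  rewrite -sum_pairs1 mulr_sumr.
  under eq_bigr do rewrite mulr_sumr.
  rewrite -prod_pairs_expR le_eqVlt; apply/orP; left; apply/eqP.
  apply: eq_bigr => i _; apply: eq_bigr => j _.
  by rewrite mulr1 lnK ?posrE.
move=> G empty x y1 y2 y3 _ xy1 _ _.
have [xy|xy] := eqVneq x y1; first by rewrite xy adj_irr in xy1.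
by have := empty x y1 xy; rewrite /= xy1.
Qed.

Lemma sum_sign (n : nat) : \sum_(i < n) (-1) ^+ i = (odd n)%:R :> R.
Proof.
elim: n => [|n IHn]; first by rewrite big_ord0.
rewrite big_ord_recr /= IHn -signr_odd.
by case: (odd n); rewrite /= ?expr1 ?expr0; ring.
Qed.

(* With signs [(-1) ^+ i], the pairs of equal parity are counted by
   [(1 + sign * sign) / 2], and the sum of all the signs is 0 or 1. *)
Lemma same_parity_le (n : nat) :
  2 * (\sum_(i < n) \sum_(j < n | (i < j)%N) (odd i == odd j)%:R)
  <= 'C(n, 2)%:R :> R.
Proof.
have parityE (i j : 'I_n) :
    2 * (odd i == odd j)%:R = 1 + (-1) ^+ i * (-1) ^+ j :> R.
  rewrite -[(-1) ^+ i]signr_odd -[(-1) ^+ j]signr_odd.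
  by case: (odd i); case: (odd j) => /=; ring.
rewrite mulr_sumr; under eq_bigr do rewrite mulr_sumr.
under eq_bigr do under eq_bigr do rewrite parityE.
under eq_bigr do rewrite big_split /=.
rewrite big_split /= sum_pairs1 gerDl.
have := @sum_sym_pairs R n (fun x y => (-1) ^+ x * (-1) ^+ y)
  (fun x y => mulrC _ _).
have -> : \sum_(x < n) \sum_(y < n) (-1) ^+ x * (-1) ^+ y =
          (odd n)%:R * (odd n)%:R :> R.
  by rewrite -sum_sign mulr_suml; apply: eq_bigr => x _; rewrite mulr_sumr.
have -> : \sum_(x < n) (-1) ^+ x * (-1) ^+ x = n%:R :> R.
  rewrite -[in RHS](card_ord n) -sumr_const; apply: eq_bigr => x _.
  by rewrite -expr2 sqrr_sign.
have : (odd n)%:R * (odd n)%:R <= n%:R :> R.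
  by rewrite -natrM ler_nat; clear parityE; case: n => [|n] //; case: (odd _).
by move: (\sum_(i < n) _) => S; lra.
Qed.

(** The cliques are the odd and the even vertices: two of any three leaves share their parity and
    are adjacent. At most half of the pairs are forced, and [ln p <= 0] turns this into a lower
    bound. *)
Lemma gnp_prob_ge_two_cliques (n : nat) :
  expR (ln p / 2 * 'C(n, 2)%:R) <= gnp_prob p (claw_free_graphs n).
Proof.
apply: le_trans (gnp_prob_ge_template
  (s := fun i j => if odd i == odd j then Some true else None) _ _).
- have -> : \prod_(i < n) \prod_(j < n | (i < j)%N)
      template_mass (if odd i == odd j then Some true else None) =
    expR (ln p *
      \sum_(i < n) \sum_(j < n | (i < j)%N) (odd i == odd j)%:R).
    rewrite mulr_sumr; under [in RHS]eq_bigr do rewrite mulr_sumr.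
    rewrite -prod_pairs_expR.
    apply: eq_bigr => i _; apply: eq_bigr => j _.
    by case: eqP => _; rewrite ?mulr0 ?mulr1 ?expR0 ?lnK ?posrE.
  rewrite ler_expR -mulrA ler_wnM2l ?ln_le0 ?(ltW hp1) //.
  rewrite [leRHS]mulrC ler_pdivlMr // mulrC.
  exact: same_parity_le.
- by move=> x y; rewrite eq_sym.
move=> G cliques x y1 y2 y3; rewrite /= !inE negb_or andbT.
move=> /andP[/andP[n12 n13] n23] _ _ _.
have clique (u v : 'I_n) : u != v -> odd u = odd v -> adj G u v.
  move=> uv par; have := cliques u v uv; rewrite par eqxx /=.
  by case: (adj G u v).
have [e12|d12] := eqVneq (odd y1) (odd y2); first by rewrite clique.
have [e13|d13] := eqVneq (odd y1) (odd y3).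
  by rewrite (clique y1 y3) // orbT.
rewrite (clique y2 y3) ?orbT //.
by move: d12 d13; case: (odd y1); case: (odd y2); case: (odd y3).
Qed.
End LowerBound.

(** * The exponent and the limit *)

Section Rate.
Variables (R : realType) (p : R).
Hypotheses (hp0 : 0 < p) (hp1 : p < 1).

Let rho := r_star p * ln 2.
Let q0 : 0 < 1 - p. Proof. by rewrite subr_gt0. Qed.
Let ln2_gt0 : 0 < ln (2 : R). Proof. by rewrite ln_gt0 // ltr1n. Qed.

(* [(3 - sqrt 5) / 2] is the root of [p = (1 - p) ^+ 2] in [0, 1]. *)
Lemma threshold_sqr : (p < (3 - Num.sqrt 5) / 2) = (p < (1 - p) ^+ 2).
Proof.
have -> : (p < (3 - Num.sqrt 5) / 2) = (Num.sqrt 5 < 3 - 2 * p).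
  by apply/idP/idP; lra.
have p3 : 0 <= 3 - 2 * p by move: hp1; lra.
rewrite -(ltr_pXn2r (_ : 0 < 2)%N) ?nnegrE ?sqrtr_ge0 // sqr_sqrtr //.
by apply/idP/idP => h; move: h; rewrite !expr2; lra.
Qed.

Lemma rate_eq : rho = if p < (1 - p) ^+ 2 then - ln (1 - p) else - (ln p / 2).
Proof.
rewrite /rho /r_star /log2 threshold_sqr; case: ifP => _; field;
  exact: lt0r_neq0.
Qed.

Lemma rate_gt0 : 0 < rho.
Proof.
have lp : ln p < 0 by rewrite ln_lt0 // hp0.
have lq : ln (1 - p) < 0 by rewrite ln_lt0 // q0 gtrBl.
by rewrite rate_eq; case: ifP => _; lra.
Qed.

(** Here [expR (- rho)] is the larger of [1 - p] and the square root of [p]; the threshold decides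
    which one it is. *)
Lemma rate_bounds : 1 - p <= expR (- rho) /\ p <= expR (- (2 * rho)).
Proof.
have -> : expR (- (2 * rho)) = expR (- rho) ^+ 2.
  by rewrite -mulrN expRM_natl.
rewrite rate_eq; case: ltP => [lt|ge]; rewrite opprK.
  by rewrite lnK ?posrE // lexx (ltW lt).
have sq : expR (ln p / 2) ^+ 2 = p.
  by rewrite -expRM_natl mulrC divfK // lnK ?posrE.
rewrite sq lexx -(ler_pXn2r (_ : 0 < 2)%N) ?nnegrE ?expR_ge0 ?(ltW q0) //.
by rewrite sq.
Qed.

Lemma gnp_prob_claw_free_ge (n : nat) :
  expR (- (rho * 'C(n, 2)%:R)) <= gnp_prob p (claw_free_graphs n).
Proof.
rewrite -mulNr rate_eq; case: ifP => _; rewrite opprK.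
  exact: gnp_prob_ge_empty.
exact: gnp_prob_ge_two_cliques.
Qed.
End Rate.

Local Open Scope classical_set_scope.

Theorem theorem1p2 (R : realType) (p : R) (hp0 : 0 < p) (hp1 : p < 1) :
  (fun n : nat =>
     1 / ('C(n, 2))%:R * log2 (gnp_prob p (claw_free_graphs n))) @ \oo
  --> - r_star p.
Proof.
have ln2_gt0 : 0 < ln (2 : R) by rewrite ln_gt0 // ltr1n.
apply/cvgrPdist_le => eps eps0.
(* The probability bounds use natural logarithms, so the tolerance is scaled by [ln 2]. *)
have eps'0 : 0 < eps * ln (2 : R) by rewrite mulr_gt0.
have [h0 h1] := rate_bounds hp0 hp1.
have [n0 up] := gnp_prob_claw_free_le hp0 hp1 (rate_gt0 hp0 hp1) h0 h1 eps'0.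
exists (maxn 2 n0) => // n /=; rewrite geq_max => /andP[n2 n0n].
have lo := gnp_prob_claw_free_ge hp0 hp1 n.
have {}up := up n n0n.
have P0 : 0 < gnp_prob p (claw_free_graphs n) by apply: lt_le_trans (expR_gt0 _) lo.
have C0 : 0 < 'C(n, 2)%:R :> R by rewrite ltr0n bin_gt0.
move: lo up; rewrite -[gnp_prob _ _](lnK P0) !ler_expR lnK ?posrE //.
rewrite /log2; set P := ln (gnp_prob _ _); set C := 'C(n, 2)%:R in C0 *.
set a := ln 2 in ln2_gt0 eps'0 *; set r := r_star p => lo up.
have -> : - r - 1 / C * (P / a) = - ((r * a) * C + P) / (C * a).
  by field; rewrite !lt0r_neq0.
rewrite ler_norml ler_pdivlMr ?ler_pdivrMr ?mulr_gt0 //.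
by apply/andP; split; lra.
Qed.
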